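(* Let $\mathbb{E}$ be a finitely complete quasi-pointed category, and let $K:\mathrm{Kt}\,\mathbb E\to \mathrm{Pt}_0\mathbb E$ be the functor associating with any split exact sequence the domain of its kernel map. If $\mathbb{E}$ is $\mathbb P$-decomposable, then $K$ is pre-fibrant on monomorphisms. If moreover $\mathbb{E}$ is protomodular, the following conditions are equivalent: (1) the category $\mathbb{E}$ is $\mathbb P$-decomposable; (2) the functor $K$ is pre-fibrant on monomorphisms; (3) in $\mathbb{E}$ any monomorphism $u:U\rightarrowtail T$ has a normalizer. When these conditions hold, $\mathbb{E}$ is necessarily stably $\mathbb P$-decomposable.
   Context: Extremal decompositions. Let $\Theta$ be a class of morphisms in a category $\mathbb{D}$ and $v:U\rightarrowtail T$ a monomorphism. A decomposition $v=w.u$ with $u:U\to X$ in $\Theta$ is $\Theta$-extremal when for any other decomposition $v=w'.u'$ with $u':U\to X'$ in $\Theta$, there is a unique $t:X'\to X$ with $w.t=w'$ and $t.u'=u$. $\mathbb{D}$ has $\Theta$-extremal decompositions of monomorphisms when any monomorphism has one; it has them stably when moreover they are stable under pullback along maps in $\Theta$. Points. $\mathrm{Pt}\,\mathbb{E}$ is the category whose objects are the split epimorphisms $(f,s):X\rightleftarrows Y$, $f.s=1_Y$, with chosen splitting, and whose maps $(y,x):(f',s')\to(f,s)$ are pairs with $f.x=y.f'$ and $x.s'=s.y$. $\mathbb P_{\mathbb E}:\mathrm{Pt}\,\mathbb E\to\mathbb E$ sends $(f,s)$ to the codomain $Y$ of $f$; its fibre over $Y$ is $\mathrm{Pt}_Y\mathbb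 E$; $(y,x)$ is $\mathbb P_{\mathbb E}$-cartesian iff $f.x=y.f'$ is a pullback square. $\mathbb{E}$ is (stably) $\mathbb P$-decomposable when $\mathrm{Pt}\,\mathbb E$ has (stably) $\Theta$-extremal decompositions of monomorphisms for $\Theta$ the class of $\mathbb P_{\mathbb E}$-cartesian maps. $\mathbb{E}$ is protomodular when every base-change functor $y^*:\mathrm{Pt}_Y\mathbb E\to \mathrm{Pt}_{Y'}\mathbb E$ (pulling back along $y:Y'\to Y$) is conservative. Quasi-pointed. $\mathbb{E}$ is quasi-pointed when it has an initial object $0$ and $0\to 1$ is a monomorphism. Then $\mathrm{Pt}_0\mathbb E$ is identified with the full subcategory of $\mathbb E$ of objects having a morphism to $0$. The kernel $k_f:K[f]\rightarrowtail X$ of $f:X\to Y$ is the pullback along $f$ of the initial map $0\rightarrowtail Y$. $\mathrm{Kt}\,\mathbb E$ is the category of split exact sequences, i.e. split epimorphisms with a chosen kernel, with morphisms the morphisms of split epimorphisms together with the induced map on the chosen kernels. Pre-fibrant. Given a functor $K:\mathbb A\to\mathbb B$, a map $f:X\to Y$ in $\mathbb A$ is $K$-pre-cartesian when it is universal among the maps in $\mathbb A$ with codomain $Y$ whose image by $K$ is $K(f)$: for any $g:Z\to Y$ with $K(g)=K(f)$ there is a unique $h:Z\to X$ with $f.h=g$ and $K(h)=1_{K(X)}$. A left exact functor $K$ is pre-fibrant on monomorphisms when for any monomorphism $u:U\rightarrowtail K(X)$ there is a monomorphic $K$-pre-cartesian map $\tilde u:\tilde U\rightarrowtail X$ whose image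 by $K$ is isomorphic to $u$. Normalizers. A monomorphism $u:U\rightarrowtail X$ is normal to an equivalence relation $R$ on $X$ when $u^{-1}(R)=\nabla_U$ (the indiscrete relation $U\times U$ on $U$) and the induced internal functor $\nabla_U\to R$ is a discrete fibration (the square formed with the first projections $p_0:U\times U\to U$ and $d_0:R\to X$ is a pullback). A monomorphism $v:U\rightarrowtail T$ has a normalizer when there is a pair $(u,R_v)$, with $u:U\rightarrowtail X$ normal to $R_v$, and $w:X\to T$ with $v=w.u$, universal among such decompositions: for any $u':U\rightarrowtail X'$ normal to $R'$ and $w':X'\to T$ with $v=w'.u'$, there is a unique $t:X'\to X$ with $w.t=w'$, $t.u'=u$ and $R'\subset t^{-1}(R_v)$. *)

(* Defs.v *)
From Stdlib Require Import IndefiniteDescription ProofIrrelevance RelationClasses.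

Set Implicit Arguments.
Unset Strict Implicit.
Unset Printing Implicit Defensive.

Declare Scope cat_scope.
Delimit Scope cat_scope with cat.
Local Open Scope cat_scope.

Reserved Notation "X ~> Y" (at level 90, right associativity).
Reserved Notation "g ∘ f" (at level 40, left associativity).

Record category := Category {
  obj :> Type;
  hom : obj -> obj -> Type;
  idm : forall X, hom X X;
  comp : forall X Y Z, hom Y Z -> hom X Y -> hom X Z;
  comp_id_l : forall X Y (f : hom X Y), comp (idm Y) f = f;
  comp_id_r : forall X Y (f : hom X Y), comp f (idm X) = f;
  comp_assoc : forall W X Y Z (h : hom Y Z) (g : hom X Y) (f : hom W X),
    comp h (comp g f) = comp (comp h g) f
}.


Arguments hom {_} _ _.
Arguments idm {_} _.
Arguments comp {_ _ _ _} _ _.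

Notation "X ~> Y" := (hom X Y) : cat_scope.
Notation "g ∘ f" := (comp g f) : cat_scope.

Definition mono (C : category) (X Y : C) (f : X ~> Y) : Prop :=
  forall (Z : C) (a b : Z ~> X), f ∘ a = f ∘ b -> a = b.

Definition is_iso (C : category) (X Y : C) (f : X ~> Y) : Prop :=
  exists g : Y ~> X, g ∘ f = idm X /\ f ∘ g = idm Y.

Definition is_terminal (C : category) (T : C) : Prop :=
  forall X : C, exists! f : X ~> T, True.

Definition is_initial (C : category) (I : C) : Prop :=
  forall X : C, exists! f : I ~> X, True.

(** [p] and [q] form a pullback of the cospan [f], [g]. *)
Definition is_pullback (C : category) (X Y Z P : C)
    (f : X ~> Z) (g : Y ~> Z) (p : P ~> X) (q : P ~> Y) : Prop :=
  f ∘ p = g ∘ q /\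
  forall (W : C) (a : W ~> X) (b : W ~> Y), f ∘ a = g ∘ b ->
    exists! c : W ~> P, p ∘ c = a /\ q ∘ c = b.

(** The morphism between two equal objects. *)
Definition eq_hom (C : category) (X Y : C) (e : X = Y) : X ~> Y :=
  match e in _ = Y' return X ~> Y' with eq_refl => idm X end.

Record functor (A B : category) := Functor {
  fobj :> A -> B;
  fmap : forall X Y : A, (X ~> Y) -> (fobj X ~> fobj Y);
  fmap_id : forall X : A, fmap (idm X) = idm (fobj X);
  fmap_comp : forall (X Y Z : A) (g : Y ~> Z) (f : X ~> Y),
    fmap (g ∘ f) = fmap g ∘ fmap f
}.

Definition conservative (A B : category) (F : functor A B) : Prop :=
  forall (X Y : A) (f : X ~> Y), is_iso (fmap F f) -> is_iso f.

Definition left_exact (A B : category) (F : functor A B) : Prop :=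
  (forall T : A, is_terminal T -> is_terminal (F T)) /\
  (forall (X Y Z P : A) (f : X ~> Z) (g : Y ~> Z) (p : P ~> X) (q : P ~> Y),
     is_pullback f g p q ->
     is_pullback (fmap F f) (fmap F g) (fmap F p) (fmap F q)).

Definition cartesian (A B : category) (F : functor A B) (X Y : A)
    (f : X ~> Y) : Prop :=
  forall (Z : A) (g : Z ~> Y) (k : F Z ~> F X), fmap F f ∘ k = fmap F g ->
    exists! h : Z ~> X, f ∘ h = g /\ fmap F h = k.

(** The equality [F g = F f] only makes sense when [F Z = F X]; [eq_hom e]
    stands for the identity of [F X] in view of that equality [e]. *)
Definition pre_cartesian (A B : category) (F : functor A B) (X Y : A)
    (f : X ~> Y) : Prop :=
  forall (Z : A) (g : Z ~> Y) (e : F Z = F X),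
    fmap F g = fmap F f ∘ eq_hom e ->
    exists! h : Z ~> X, f ∘ h = g /\ fmap F h = eq_hom e.

Definition pre_fibrant_on_monos (A B : category) (F : functor A B) : Prop :=
  left_exact F /\
  forall (X : A) (U : B) (u : U ~> F X), mono u ->
    exists (U' : A) (u' : U' ~> X) (i : F U' ~> U),
      mono u' /\ pre_cartesian F u' /\ is_iso i /\ u ∘ i = fmap F u'.

(** ** Extremal decompositions *)

Definition morphism_class (D : category) := forall X Y : D, (X ~> Y) -> Prop.

Definition is_extremal_decomposition (D : category) (Theta : morphism_class D)
    (U X T : D) (v : U ~> T) (u : U ~> X) (w : X ~> T) : Prop :=
  v = w ∘ u /\ Theta _ _ u /\
  forall (X' : D) (u' : U ~> X') (w' : X' ~> T),
    v = w' ∘ u' -> Theta _ _ u' ->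
    exists! t : X' ~> X, w ∘ t = w' /\ t ∘ u' = u.

Definition has_extremal_decompositions (D : category)
    (Theta : morphism_class D) : Prop :=
  forall (U T : D) (v : U ~> T), mono v ->
    exists (X : D) (u : U ~> X) (w : X ~> T),
      is_extremal_decomposition Theta v u w.

(** Pulling [v = w ∘ u] back along [theta] gives the two squares
<<
      U' --u'--> X' --w'--> T'
      |a         |b         | theta
      U  --u-->  X  --w-->  T
>>
*)
Definition extremal_decompositions_stable (D : category)
    (Theta : morphism_class D) : Prop :=
  forall (U X T : D) (v : U ~> T) (u : U ~> X) (w : X ~> T),
    mono v -> is_extremal_decomposition Theta v u w ->
    forall (T' : D) (theta : T' ~> T), Theta _ _ theta ->
    forall (X' : D) (b : X' ~> X) (w' : X' ~> T'), is_pullback w theta b w' ->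
    forall (U' : D) (a : U' ~> U) (u' : U' ~> X'), is_pullback u b a u' ->
      is_extremal_decomposition Theta (w' ∘ u') u' w'.

Definition stably_has_extremal_decompositions (D : category)
    (Theta : morphism_class D) : Prop :=
  has_extremal_decompositions Theta /\ extremal_decompositions_stable Theta.

(** ** Finitely complete and quasi-pointed categories *)

Record finitely_complete (E : category) := FinitelyComplete {
  one : E;
  one_terminal : is_terminal one;
  pb : forall X Y Z : E, (X ~> Z) -> (Y ~> Z) -> E;
  pb1 : forall (X Y Z : E) (f : X ~> Z) (g : Y ~> Z), pb f g ~> X;
  pb2 : forall (X Y Z : E) (f : X ~> Z) (g : Y ~> Z), pb f g ~> Y;
  pb_pullback : forall (X Y Z : E) (f : X ~> Z) (g : Y ~> Z),
    is_pullback f g (pb1 f g) (pb2 f g)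
}.

Definition the (A : Type) (P : A -> Prop) (h : exists! x, P x) : A :=
  proj1_sig (constructive_definite_description P h).

Lemma the_spec (A : Type) (P : A -> Prop) (h : exists! x, P x) : P (the h).
Proof. exact (proj2_sig (constructive_definite_description P h)). Qed.

Record quasi_pointed (E : category) (L : finitely_complete E) := QuasiPointed {
  zero : E;
  zero_initial : is_initial zero;
  zero_one_mono : forall f : zero ~> one L, mono f
}.

Lemma is_pullback_eq (C : category) (X Y Z P : C)
    (f : X ~> Z) (g : Y ~> Z) (p : P ~> X) (q : P ~> Y) :
  is_pullback f g p q ->
  forall (W : C) (c d : W ~> P), p ∘ c = p ∘ d -> q ∘ c = q ∘ d -> c = d.
Proof.
  intros [H U] W c d H1 H2.
  destruct (U W (p ∘ d) (q ∘ d)) as [e [_ He]].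
  - now rewrite !comp_assoc, H.
  - rewrite <- (He c), <- (He d); auto.
Qed.

Section Limits.
Variables (E : category) (L : finitely_complete E).

Definition to_one (X : E) : X ~> one L := the (one_terminal L X).

Definition pb_lift (X Y Z W : E) (f : X ~> Z) (g : Y ~> Z)
    (a : W ~> X) (b : W ~> Y) (h : f ∘ a = g ∘ b) : W ~> pb L f g :=
  the (proj2 (pb_pullback L f g) W a b h).

Lemma pb_lift1 (X Y Z W : E) (f : X ~> Z) (g : Y ~> Z)
    (a : W ~> X) (b : W ~> Y) (h : f ∘ a = g ∘ b) :
  pb1 L f g ∘ pb_lift h = a.
Proof. exact (proj1 (the_spec (proj2 (pb_pullback L f g) W a b h))). Qed.

Lemma pb_lift2 (X Y Z W : E) (f : X ~> Z) (g : Y ~> Z)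
    (a : W ~> X) (b : W ~> Y) (h : f ∘ a = g ∘ b) :
  pb2 L f g ∘ pb_lift h = b.
Proof. exact (proj2 (the_spec (proj2 (pb_pullback L f g) W a b h))). Qed.

Lemma pb_comm (X Y Z : E) (f : X ~> Z) (g : Y ~> Z) :
  f ∘ pb1 L f g = g ∘ pb2 L f g.
Proof. exact (proj1 (pb_pullback L f g)). Qed.

Lemma to_one_unique (X : E) (f g : X ~> one L) : f = g.
Proof.
  destruct (one_terminal L X) as [h [_ H]].
  now rewrite <- (H f I), <- (H g I).
Qed.

Definition prod (X Y : E) : E := pb L (to_one X) (to_one Y).
Definition prod1 (X Y : E) : prod X Y ~> X := pb1 L (to_one X) (to_one Y).
Definition prod2 (X Y : E) : prod X Y ~> Y := pb2 L (to_one X) (to_one Y).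

Definition pair (X Y W : E) (a : W ~> X) (b : W ~> Y) : W ~> prod X Y :=
  pb_lift (to_one_unique (to_one X ∘ a) (to_one Y ∘ b)).

Lemma prod1_pair (X Y W : E) (a : W ~> X) (b : W ~> Y) :
  prod1 X Y ∘ pair a b = a.
Proof. apply pb_lift1. Qed.

Lemma prod2_pair (X Y W : E) (a : W ~> X) (b : W ~> Y) :
  prod2 X Y ∘ pair a b = b.
Proof. apply pb_lift2. Qed.

Definition prod_map (X X' Y Y' : E) (a : X ~> X') (b : Y ~> Y') :
  prod X Y ~> prod X' Y' := pair (a ∘ prod1 X Y) (b ∘ prod2 X Y).

End Limits.

Section QuasiPointed.
Variables (E : category) (L : finitely_complete E) (Q : quasi_pointed L).

Definition from_zero (X : E) : zero Q ~> X := the (zero_initial Q X).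

Lemma from_zero_unique (X : E) (f g : zero Q ~> X) : f = g.
Proof.
  destruct (zero_initial Q X) as [h [_ H]].
  now rewrite <- (H f I), <- (H g I).
Qed.

Lemma to_zero_unique (X : E) (f g : X ~> zero Q) : f = g.
Proof.
  apply (@zero_one_mono _ _ Q (from_zero (one L))), to_one_unique.
Qed.

End QuasiPointed.

(** ** Points *)

Section Points.
Variable E : category.

(** A split epimorphism with codomain [Y] and a chosen splitting. *)
Record point (Y : E) := Point {
  total : E;
  proj : total ~> Y;
  sect : Y ~> total;
  proj_sect : proj ∘ sect = idm Y
}.

Record point_hom (Y : E) (p q : point Y) := PointHom {
  total_map :> total p ~> total q;
  total_map_proj : proj q ∘ total_map = proj p;
  total_map_sect : total_map ∘ sect p = sect q
}.

Lemma point_hom_eq (Y : E) (p q : point Y) (a b : point_hom p q) :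
  total_map a = total_map b -> a = b.
Proof.
  destruct a, b; simpl; intros ->; f_equal; apply proof_irrelevance.
Qed.

Definition point_id (Y : E) (p : point Y) : point_hom p p.
Proof.
  refine (@PointHom Y p p (idm (total p)) _ _).
  - apply comp_id_r.
  - apply comp_id_l.
Defined.

Definition point_comp (Y : E) (p q r : point Y)
    (b : point_hom q r) (a : point_hom p q) : point_hom p r.
Proof.
  refine (@PointHom Y p r (total_map b ∘ total_map a) _ _).
  - rewrite comp_assoc, (total_map_proj b); apply total_map_proj.
  - rewrite <- comp_assoc, (total_map_sect a); apply total_map_sect.
Defined.

(** The fibre [Pt_Y E]. *)
Definition PtOver (Y : E) : category.
Proof.
  refine (@Category (point Y) (@point_hom Y) (@point_id Y) (@point_comp Y) _ _ _);
    intros; apply point_hom_eq; simpl.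
  - apply comp_id_l.
  - apply comp_id_r.
  - apply comp_assoc.
Defined.

Record pt := PtObj {
  base : E;
  pt_point :> point base
}.

Record pt_hom (p q : pt) := PtHom {
  pt_base_map : base p ~> base q;
  pt_total_map : total p ~> total q;
  pt_map_proj : proj q ∘ pt_total_map = pt_base_map ∘ proj p;
  pt_map_sect : pt_total_map ∘ sect p = sect q ∘ pt_base_map
}.

Lemma pt_hom_eq (p q : pt) (a b : pt_hom p q) :
  pt_base_map a = pt_base_map b -> pt_total_map a = pt_total_map b -> a = b.
Proof.
  destruct a, b; simpl; intros -> ->; f_equal; apply proof_irrelevance.
Qed.

Definition pt_id (p : pt) : pt_hom p p.
Proof.
  refine (@PtHom p p (idm (base p)) (idm (total p)) _ _);
    now rewrite comp_id_l, comp_id_r.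
Defined.

Definition pt_comp (p q r : pt) (b : pt_hom q r) (a : pt_hom p q) :
  pt_hom p r.
Proof.
  refine (@PtHom p r (pt_base_map b ∘ pt_base_map a)
            (pt_total_map b ∘ pt_total_map a) _ _).
  - now rewrite comp_assoc, (pt_map_proj b), <- comp_assoc, (pt_map_proj a),
      comp_assoc.
  - now rewrite <- comp_assoc, (pt_map_sect a), comp_assoc, (pt_map_sect b),
      comp_assoc.
Defined.

Definition Pt : category.
Proof.
  refine (@Category pt pt_hom pt_id pt_comp _ _ _);
    intros; apply pt_hom_eq; simpl;
    first [apply comp_id_l | apply comp_id_r | apply comp_assoc].
Defined.

Definition PE : functor Pt E.
Proof.
  now refine (@Functor Pt E (fun p : pt => base p)
                (fun p q (a : pt_hom p q) => pt_base_map a) _ _).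
Defined.

Definition PE_cartesian : morphism_class Pt := fun p q a => cartesian PE a.

Definition P_decomposable : Prop := has_extremal_decompositions PE_cartesian.

Definition stably_P_decomposable : Prop :=
  stably_has_extremal_decompositions PE_cartesian.

End Points.

(** ** Base change and protomodularity *)

Section Protomodular.
Variables (E : category) (L : finitely_complete E).

Lemma base_change_sect_comm (Y Y' : E) (y : Y' ~> Y) (p : point Y) :
  proj p ∘ (sect p ∘ y) = y ∘ idm Y'.
Proof. now rewrite comp_assoc, proj_sect, comp_id_l, comp_id_r. Qed.

Lemma base_change_map_comm (Y Y' : E) (y : Y' ~> Y) (p q : point Y)
    (a : point_hom p q) :
  proj q ∘ (a ∘ pb1 L (proj p) y) = y ∘ pb2 L (proj p) y.
Proof. rewrite comp_assoc, total_map_proj; apply pb_comm. Qed.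

Definition base_change_obj (Y Y' : E) (y : Y' ~> Y) (p : point Y) : point Y' :=
  {| total := pb L (proj p) y;
     proj := pb2 L (proj p) y;
     sect := pb_lift L (base_change_sect_comm y p);
     proj_sect := pb_lift2 L (base_change_sect_comm y p) |}.

Definition base_change_map (Y Y' : E) (y : Y' ~> Y) (p q : point Y)
    (a : point_hom p q) : point_hom (base_change_obj y p) (base_change_obj y q).
Proof.
  refine (@PointHom _ _ (base_change_obj y p) (base_change_obj y q)
            (pb_lift L (base_change_map_comm y a)) _ _); simpl.
  - apply pb_lift2.
  - apply (is_pullback_eq (pb_pullback L (proj q) y)); rewrite comp_assoc.
    + now rewrite !pb_lift1, <- comp_assoc, pb_lift1, comp_assoc, total_map_sect.
    + now rewrite !pb_lift2.
Defined.

Definition base_change (Y Y' : E) (y : Y' ~> Y) :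
  functor (PtOver Y) (PtOver Y').
Proof.
  refine (@Functor (PtOver Y) (PtOver Y') (base_change_obj y)
            (fun p q a => base_change_map y a) _ _).
  - intros p; apply point_hom_eq; simpl.
    apply (is_pullback_eq (pb_pullback L (proj p) y)).
    + now rewrite pb_lift1, comp_id_l, comp_id_r.
    + now rewrite pb_lift2, comp_id_r.
  - intros p q r b a; apply point_hom_eq; simpl.
    apply (is_pullback_eq (pb_pullback L (proj r) y)); rewrite comp_assoc.
    + now rewrite !pb_lift1, <- !comp_assoc, pb_lift1.
    + now rewrite !pb_lift2.
Defined.

Definition protomodular : Prop :=
  forall (Y Y' : E) (y : Y' ~> Y), conservative (base_change y).

End Protomodular.

(** ** Split exact sequences *)

Section SplitExact.
Variables (E : category) (L : finitely_complete E) (Q : quasi_pointed L).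

Record kt := KtObj {
  kt_pt :> pt E;
  ker : E;
  ker_incl : ker ~> total kt_pt;
  ker_zero : ker ~> zero Q;
  ker_pullback :
    is_pullback (proj kt_pt) (from_zero Q (base kt_pt)) ker_incl ker_zero
}.

(** The condition [ker_map_incl] determines [ker_map]; compatibility with
    [ker_zero] is automatic, see [to_zero_unique]. *)
Record kt_hom (p q : kt) := KtHom {
  kt_pt_hom :> pt_hom p q;
  ker_map : ker p ~> ker q;
  ker_map_incl : ker_incl q ∘ ker_map = pt_total_map kt_pt_hom ∘ ker_incl p
}.

Lemma kt_hom_eq (p q : kt) (a b : kt_hom p q) :
  kt_pt_hom a = kt_pt_hom b -> ker_map a = ker_map b -> a = b.
Proof.
  destruct a, b; simpl; intros -> ->; f_equal; apply proof_irrelevance.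
Qed.

Definition kt_id (p : kt) : kt_hom p p.
Proof.
  refine (@KtHom p p (pt_id p) (idm (ker p)) _); simpl.
  now rewrite comp_id_l, comp_id_r.
Defined.

Definition kt_comp (p q r : kt) (b : kt_hom q r) (a : kt_hom p q) :
  kt_hom p r.
Proof.
  refine (@KtHom p r (pt_comp b a) (ker_map b ∘ ker_map a) _); simpl.
  now rewrite comp_assoc, (ker_map_incl b), <- comp_assoc, (ker_map_incl a),
    comp_assoc.
Defined.

Definition Kt : category.
Proof.
  refine (@Category kt kt_hom kt_id kt_comp _ _ _);
    intros; apply kt_hom_eq; simpl;
    first [ apply comp_id_l | apply comp_id_r | apply comp_assoc
          | apply (comp_id_l (c := Pt E)) | apply (comp_id_r (c := Pt E))
          | apply (comp_assoc (c := Pt E)) ].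
Defined.

(** The kernel [ker p ~> 0], with its only possible splitting, is an object of
    the fibre over [0]; that fibre is the full subcategory of the objects having
    a morphism to [0], by [from_zero_unique] and [to_zero_unique]. *)
Definition kernel_point (p : kt) : point (zero Q) :=
  {| total := ker p;
     proj := ker_zero p;
     sect := from_zero Q (ker p);
     proj_sect := from_zero_unique (ker_zero p ∘ from_zero Q (ker p)) (idm _) |}.

Definition kernel_map (p q : kt) (a : kt_hom p q) :
  point_hom (kernel_point p) (kernel_point q) :=
  @PointHom E (zero Q) (kernel_point p) (kernel_point q) (ker_map a)
    (to_zero_unique _ _) (from_zero_unique _ _).

Definition kernel_functor : functor Kt (PtOver (zero Q)).
Proof.
  refine (@Functor Kt (PtOver (zero Q)) kernel_point kernel_map _ _);
    intros; now apply point_hom_eq.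
Defined.

End SplitExact.

(** ** Equivalence relations and normalizers *)

Section Normalizers.
Variables (E : category) (L : finitely_complete E).

Record relation (X : E) := Relation {
  rel_obj :> E;
  d0 : rel_obj ~> X;
  d1 : rel_obj ~> X;
  d_jointly_mono : forall (W : E) (a b : W ~> rel_obj),
    d0 ∘ a = d0 ∘ b -> d1 ∘ a = d1 ∘ b -> a = b
}.

Definition related (X : E) (R : relation X) (W : E) (a b : W ~> X) : Prop :=
  exists r : W ~> R, d0 R ∘ r = a /\ d1 R ∘ r = b.

Record equiv_relation (X : E) := EquivRelation {
  equiv_rel :> relation X;
  equiv_rel_equivalence : forall W : E, Equivalence (@related X equiv_rel W)
}.

Definition rel_incl (X : E) (R S : relation X) : Prop :=
  exists i : R ~> S, d0 S ∘ i = d0 R /\ d1 S ∘ i = d1 R.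

(** Equality as subobjects of [X * X]. *)
Definition rel_eq (X : E) (R S : relation X) : Prop :=
  rel_incl R S /\ rel_incl S R.

Definition nabla (U : E) : relation U :=
  {| rel_obj := prod L U U;
     d0 := prod1 L U U;
     d1 := prod2 L U U;
     d_jointly_mono := is_pullback_eq (pb_pullback L (to_one L U) (to_one L U)) |}.

(** The pullback of [(d0, d1) : R ~> X * X] along [u * u]. *)
Definition inverse_image (U X : E) (u : U ~> X) (R : relation X) : relation U.
Proof.
  set (uu := prod_map L u u).
  set (dd := pair L (d0 R) (d1 R)).
  refine (@Relation U (pb L uu dd)
            (prod1 L U U ∘ pb1 L uu dd) (prod2 L U U ∘ pb1 L uu dd) _).
  intros W a b; rewrite <- !comp_assoc; intros H0 H1.
  assert (H : pb1 L uu dd ∘ a = pb1 L uu dd ∘ b)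
    by exact (d_jointly_mono (r := nabla U) H0 H1).
  apply (is_pullback_eq (pb_pullback L uu dd)); trivial.
  assert (H' : dd ∘ (pb2 L uu dd ∘ a) = dd ∘ (pb2 L uu dd ∘ b)).
  { now rewrite !comp_assoc, <- pb_comm, <- !comp_assoc, H. }
  apply (d_jointly_mono (r := R)).
  - rewrite <- (prod1_pair L (d0 R) (d1 R)), <- !comp_assoc; fold dd.
    now rewrite H'.
  - rewrite <- (prod2_pair L (d0 R) (d1 R)), <- !comp_assoc; fold dd.
    now rewrite H'.
Defined.

(** [phi] is the internal functor from [nabla U] to [R] induced by [u]; it is
    unique since [d0] and [d1] are jointly monomorphic. *)
Definition normal_to (U X : E) (u : U ~> X) (R : equiv_relation X) : Prop :=
  mono u /\ rel_eq (inverse_image u R) (nabla U) /\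
  exists phi : nabla U ~> R,
    d0 R ∘ phi = u ∘ d0 (nabla U) /\
    d1 R ∘ phi = u ∘ d1 (nabla U) /\
    is_pullback (d0 R) u phi (d0 (nabla U)).

Definition has_normalizer (U T : E) (v : U ~> T) : Prop :=
  exists (X : E) (u : U ~> X) (R : equiv_relation X) (w : X ~> T),
    normal_to u R /\ v = w ∘ u /\
    forall (X' : E) (u' : U ~> X') (R' : equiv_relation X') (w' : X' ~> T),
      normal_to u' R' -> v = w' ∘ u' ->
      exists! t : X' ~> X,
        w ∘ t = w' /\ t ∘ u' = u /\ rel_incl R' (inverse_image t R).

End Normalizers.

(* Main.v *)
From Stdlib Require Import RelationClasses.
Require Import Defs.

(** Write [Pt] for the category of points. A map of points is cartesian exactly
    when its square is a pullback ([cartesian_iff_pullback_square]). The second component of an extremal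
    decomposition of a monomorphism is always a monomorphism ([extremal_mono]).

    _Kernels._ An object [U] with a map to the initial object is the same as a
    point over it, and a cartesian map from [U] to a point is the same as a
    kernel of that point. Under this dictionary a pre-cartesian lifting of a
    subobject [U] of the kernel of [T] is an extremal decomposition of the
    composite of [U] with the kernel inclusion. So the kernel functor, which has
    a left adjoint and is therefore left exact, is pre-fibrant on monomorphisms
    exactly when the monomorphisms of [Pt] with domain over zero have extremal
    decompositions ([pre_fibrant_of_decomposable],
    [decomposable_of_pre_fibrant]).

    _Protomodularity_ reduces every question about a decomposition [v = w.u] to
    kernels. If [c] is the kernel of the domain of [v], then [u] is cartesian as
    soon as [u.c] is ([cartesian_cancel_right]); hence an extremal decomposition
    of [v.c] extends to one of [v] ([decomposable_of_over_zero]), and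
    conversely extremality is inherited by [v.c] ([restriction_extremal]).
    Stability follows since cartesian maps identify kernels
    ([extremal_stable]).

    _From decompositions to normalizers._ A subobject [v] of [T] gives a map of
    points from [nabla U] to [nabla T]. Its extremal decomposition passes
    through a point [(f, s)] on a subobject [X] of [T], whose elements over [x]
    are elements of [T]. A second use of extremality shows that they lie in [X]
    and that they form the classes of an equivalence relation, for which [X] is
    the normalizer ([normalizer_of_decomposition]).

    _From normalizers to decompositions._ Let [U] be contained in the kernel of
    the point [T] with base [Y], and let [N] be its normalizer in the total
    object of [T], with relation [R]. The point of [R] has kernel [U]; restricted
    to the part of [Y] that lies in [N], it is the middle object of the extremal
    decomposition ([extremal_of_normalizer]). It maps to [T] because [R] is
    contained in the kernel pair of the projection to [Y]
    ([proj_coequalizes]): section and kernel of a point are jointly epimorphic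
    in a protomodular category ([jointly_epi]). *)

Set Implicit Arguments.
Unset Strict Implicit.
Unset Printing Implicit Defensive.

Local Open Scope cat_scope.

Local Notation "X ⇒ Y" := (@hom (Pt _) X Y) (at level 90, right associativity).

(** * Composites and pullbacks *)

Lemma postcompose (C : category) (X Y Z : C) (g : Y ~> Z) (f : X ~> Y)
    (k : X ~> Z) (H : g ∘ f = k) (W : C) (h : W ~> X) : g ∘ (f ∘ h) = k ∘ h.
Proof. now rewrite <- H, comp_assoc. Qed.

(** Rewrites with an equation between composites wherever its left-hand side
    occurs, also in the middle of a right-bracketed chain. *)
Ltac rw H := rewrite <- ?comp_assoc;
  first [rewrite (postcompose H) | rewrite H
        | cbn; first [rewrite (postcompose H) | rewrite H]];
  rewrite <- ?comp_assoc.

(** The two components of an equation between maps of points. *)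
Ltac components H Hb Ht :=
  pose proof (f_equal (@pt_base_map _ _ _) H) as Hb;
  pose proof (f_equal (@pt_total_map _ _ _) H) as Ht;
  cbn in Hb, Ht.

Lemma is_pullback_sym (C : category) (X Y Z P : C) (f : X ~> Z) (g : Y ~> Z)
    (p : P ~> X) (q : P ~> Y) : is_pullback f g p q -> is_pullback g f q p.
Proof.
  intros [H U]; split; [now symmetry|].
  intros W a b Hab; destruct (U W b a (eq_sym Hab)) as [c [[H1 H2] Hc]].
  exists c; split; [now split|]; intros d [? ?]; now apply Hc.
Qed.

(** Existence and joint monicity are all there is to a pullback. *)
Lemma is_pullback_intro (C : category) (X Y Z P : C) (f : X ~> Z) (g : Y ~> Z)
    (p : P ~> X) (q : P ~> Y) :
  f ∘ p = g ∘ q ->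
  (forall (W : C) (a : W ~> X) (b : W ~> Y), f ∘ a = g ∘ b ->
     exists c : W ~> P, p ∘ c = a /\ q ∘ c = b) ->
  (forall (W : C) (c d : W ~> P), p ∘ c = p ∘ d -> q ∘ c = q ∘ d -> c = d) ->
  is_pullback f g p q.
Proof.
  intros H Ex Un; split; trivial; intros W a b Hab.
  destruct (Ex W a b Hab) as [c [H1 H2]]; exists c; split; [now split|].
  intros d [H3 H4]; apply Un; congruence.
Qed.

Lemma is_pullback_iso (C : category) (X Y Z P P' : C) (f : X ~> Z) (g : Y ~> Z)
    (p : P ~> X) (q : P ~> Y) (i : P' ~> P) :
  is_pullback f g p q -> is_iso i -> is_pullback f g (p ∘ i) (q ∘ i).
Proof.
  intros PB [j [Hji Hij]]; apply is_pullback_intro.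
  - now rw (proj1 PB).
  - intros W a b Hab; destruct (proj2 PB W a b Hab) as [c [[<- <-] _]].
    exists (j ∘ c); now split; rw Hij; rewrite comp_id_l.
  - intros W c d; rewrite <- !comp_assoc; intros H1 H2.
    pose proof (is_pullback_eq PB H1 H2) as H.
    now rewrite <- (comp_id_l c), <- Hji, <- comp_assoc, H, comp_assoc, Hji,
      comp_id_l.
Qed.

Lemma mono_pullback (C : category) (X Y Z P : C) (f : X ~> Z) (g : Y ~> Z)
    (p : P ~> X) (q : P ~> Y) : is_pullback f g p q -> mono f -> mono q.
Proof.
  intros H Mf W a b Hab; apply (is_pullback_eq H); trivial.
  apply Mf; destruct H as [H _].
  now rw H; rewrite Hab; rw (eq_sym H).
Qed.

Lemma mono_comp (C : category) (X Y Z : C) (g : Y ~> Z) (f : X ~> Y) :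
  mono g -> mono f -> mono (g ∘ f).
Proof.
  intros Mg Mf W a b Hab; apply Mf, Mg; now rewrite !comp_assoc.
Qed.

Lemma mono_cancel (C : category) (X Y Z : C) (g : Y ~> Z) (f : X ~> Y) :
  mono (g ∘ f) -> mono f.
Proof.
  intros M W a b Hab; apply M; now rewrite <- !comp_assoc, Hab.
Qed.

Lemma eq_hom_iso (C : category) (X Y : C) (e : X = Y) : is_iso (eq_hom e).
Proof. destruct e; exists (idm X); now rewrite !comp_id_l. Qed.

(** * Cartesian maps *)

Lemma cartesian_comp (A B : category) (F : functor A B) (X Y Z : A)
    (g : Y ~> Z) (f : X ~> Y) :
  cartesian F g -> cartesian F f -> cartesian F (g ∘ f).
Proof.
  intros Cg Cf W k l Hl; rewrite fmap_comp, <- comp_assoc in Hl.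
  destruct (Cg W k (fmap F f ∘ l) Hl) as [h1 [[H1 H2] U1]].
  destruct (Cf W h1 l (eq_sym H2)) as [h [[H3 H4] U2]].
  exists h; split; [split; trivial; now rewrite <- comp_assoc, H3|].
  intros h' [H5 H6]; apply U2; split; trivial.
  symmetry; apply U1; split; [now rewrite comp_assoc|].
  now rewrite fmap_comp, H6.
Qed.

Lemma cartesian_cancel (A B : category) (F : functor A B) (X Y Z : A)
    (g : Y ~> Z) (f : X ~> Y) :
  cartesian F g -> cartesian F (g ∘ f) -> cartesian F f.
Proof.
  intros Cg Cgf W k l Hl.
  assert (Hgf : fmap F (g ∘ f) ∘ l = fmap F (g ∘ k))
    by now rewrite !fmap_comp, <- comp_assoc, Hl.
  destruct (Cgf W (g ∘ k) l Hgf) as [h [[H1 H2] U]].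
  exists h; split.
  - split; trivial.
    destruct (Cg W (g ∘ k) (fmap F k) (eq_sym (fmap_comp F g k))) as [m [_ Um]].
    rewrite <- (Um k), <- (Um (f ∘ h)); auto; split.
    + now rewrite comp_assoc.
    + now rewrite fmap_comp, H2.
  - intros h' [H3 H4]; apply U; split; trivial; now rewrite <- comp_assoc, H3.
Qed.

Section Points.
Variables (E : category) (L : finitely_complete E).

(** The functor [PE] has a left adjoint, sending [W] to its identity; hence it
    preserves whatever is defined by a limit. *)
Definition id_pt (W : E) : pt E :=
  @PtObj E W (@Point E W W (idm W) (idm W) (comp_id_l (idm W))).

Lemma id_pt_hom_ok (W : E) (X : pt E) (a : W ~> base X) :
  proj X ∘ (sect X ∘ a) = a ∘ idm W.
Proof. now rewrite comp_assoc, proj_sect, comp_id_l, comp_id_r. Qed.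

Definition id_pt_hom (W : E) (X : pt E) (a : W ~> base X) : id_pt W ⇒ X :=
  @PtHom E (id_pt W) X a (sect X ∘ a) (id_pt_hom_ok a) (comp_id_r _).

Lemma id_pt_hom_comp (W : E) (X Y : pt E) (f : X ⇒ Y) (a : W ~> base X) :
  f ∘ id_pt_hom a = id_pt_hom (pt_base_map f ∘ a).
Proof. apply pt_hom_eq; cbn; trivial; now rw (pt_map_sect f). Qed.

(** Compatibility with the base map in the definition of a cartesian map can be
    tested after composing with the sides of the square, since [PE] preserves
    the joint monicity of its sides. *)
Lemma cartesian_pullback (X Y Z P : pt E) (f : X ⇒ Z) (g : Y ⇒ Z)
    (p : P ⇒ X) (q : P ⇒ Y) :
  is_pullback f g p q -> PE_cartesian f -> PE_cartesian q.
Proof.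
  intros PB Cf W k l Hl; cbn in k, l, Hl.
  pose proof PB as [Sq U]; components Sq Sqb Sqt.
  assert (Hf : fmap (PE E) f ∘ (pt_base_map p ∘ l) = fmap (PE E) (g ∘ k)).
  { cbn; rw Sqb; now rewrite Hl. }
  destruct (Cf W (g ∘ k) _ Hf) as [m [[H1 H2] _]]; cbn in H2.
  destruct (U W m k H1) as [h [[H3 H4] Uh]].
  exists h; split.
  - split; trivial; cbn.
    components H3 H3b H3t; components H4 H4b H4t.
    assert (Heq : id_pt_hom (pt_base_map h) = id_pt_hom l).
    { apply (is_pullback_eq PB); rewrite !id_pt_hom_comp; f_equal; congruence. }
    now apply (f_equal (@pt_base_map _ _ _)) in Heq.
  - intros h' [H5 H6]; cbn in H6; apply Uh; split; trivial.
    assert (Hc : fmap (PE E) f ∘ (pt_base_map p ∘ l) = fmap (PE E) (f ∘ m))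
      by now rewrite H1.
    destruct (Cf W (f ∘ m) _ Hc) as [n [_ Un]].
    rewrite <- (Un m), <- (Un (p ∘ h')); trivial; split; trivial.
    + rw Sq; now rewrite H5, <- H1.
    + cbn; now rewrite H6.
Qed.

Definition pullback_square (X Y : pt E) (f : X ⇒ Y) : Prop :=
  is_pullback (proj Y) (pt_base_map f) (pt_total_map f) (proj X).

Lemma pullback_square_cartesian (X Y : pt E) (f : X ⇒ Y) :
  pullback_square f -> PE_cartesian f.
Proof.
  intros PB Z g k Hk; cbn in k, Hk.
  assert (Hsq : proj Y ∘ pt_total_map g = pt_base_map f ∘ (k ∘ proj Z)).
  { rewrite comp_assoc, Hk; apply pt_map_proj. }
  destruct (proj2 PB _ _ _ Hsq) as [h [[H1 H2] Uh]].
  assert (Hs : h ∘ sect Z = sect X ∘ k).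
  { apply (is_pullback_eq PB).
    - rw H1; rw (pt_map_sect f); now rewrite Hk, pt_map_sect.
    - rw H2; rw (proj_sect X); now rewrite proj_sect, comp_id_l, comp_id_r. }
  exists (@PtHom E Z X k h H2 Hs); split.
  - split; trivial; now apply pt_hom_eq.
  - intros h' [H3 H4]; cbn in H4.
    apply pt_hom_eq; cbn; [now symmetry|].
    components H3 H3b H3t.
    apply Uh; split; trivial; now rewrite pt_map_proj, H4.
Qed.

(** ** The comparison with a base change *)

Section Comparison.
Variables (X Z : pt E) (u : X ⇒ Z).

Definition base_change_pt : pt E :=
  @PtObj E (base X) (base_change_obj L (pt_base_map u) Z).

Definition base_change_pt_proj : base_change_pt ⇒ Z :=
  @PtHom E base_change_pt Z (pt_base_map u) (pb1 L _ _) (pb_comm L _ _)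
    (pb_lift1 L (base_change_sect_comm (pt_base_map u) Z)).

Lemma base_change_pt_cartesian : PE_cartesian base_change_pt_proj.
Proof. apply pullback_square_cartesian, pb_pullback. Qed.

Definition comparison_map : total X ~> total base_change_pt :=
  pb_lift L (pt_map_proj u).

Lemma comparison_sect : comparison_map ∘ sect X = sect base_change_pt.
Proof.
  apply (is_pullback_eq (pb_pullback L (proj Z) (pt_base_map u))); cbn.
  - unfold comparison_map; rw (pb_lift1 L (pt_map_proj u)).
    now rewrite pb_lift1, pt_map_sect.
  - unfold comparison_map; rw (pb_lift2 L (pt_map_proj u)).
    now rewrite pb_lift2, proj_sect.
Qed.

Definition comparison_point_hom :
  point_hom X (base_change_obj L (pt_base_map u) Z) :=
  @PointHom E (base X) X base_change_pt comparison_map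
    (pb_lift2 L (pt_map_proj u)) comparison_sect.

Lemma comparison_proj_ok :
  proj base_change_pt ∘ comparison_map = idm (base X) ∘ proj X.
Proof. rewrite comp_id_l; apply (total_map_proj comparison_point_hom). Qed.

Definition comparison : X ⇒ base_change_pt :=
  @PtHom E X base_change_pt (idm (base X)) comparison_map comparison_proj_ok
    (eq_trans comparison_sect (eq_sym (comp_id_r _))).

Lemma comparison_factor : base_change_pt_proj ∘ comparison = u.
Proof. apply pt_hom_eq; cbn; [apply comp_id_r | apply pb_lift1]. Qed.

Lemma pullback_square_of_comparison_iso :
  is_iso comparison_map -> pullback_square u.
Proof.
  intros I; pose proof (is_pullback_iso (pb_pullback L _ _) I) as H.
  unfold comparison_map in H; now rewrite pb_lift1, pb_lift2 in H.
Qed.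

End Comparison.

(** Two cartesian maps to [Y] over the same base map, here [f] and the
    projection of the base change, differ by an isomorphism. *)
Lemma cartesian_iff_pullback_square (X Y : pt E) (f : X ⇒ Y) :
  PE_cartesian f <-> pullback_square f.
Proof.
  split; [intros Cf | apply pullback_square_cartesian].
  apply pullback_square_of_comparison_iso.
  destruct (Cf _ (base_change_pt_proj f) (idm (base X)) (comp_id_r _))
    as [h [[H1 H2] _]].
  assert (U1 : h ∘ comparison f = idm (X : Pt E)).
  { destruct (Cf X f (idm (base X)) (comp_id_r _)) as [i [_ Ui]].
    transitivity i; [symmetry|]; apply Ui; split.
    - now rewrite comp_assoc, H1, comparison_factor.
    - rewrite fmap_comp, H2; apply comp_id_l.
    - apply (comp_id_r (c := Pt E)).
    - reflexivity. }
  assert (U2 : comparison f ∘ h = idm (base_change_pt f : Pt E)).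
  { destruct (base_change_pt_cartesian (g := base_change_pt_proj f)
      (k := idm (base X)) (comp_id_r _)) as [i [_ Ui]].
    transitivity i; [symmetry|]; apply Ui; split.
    - now rewrite comp_assoc, comparison_factor.
    - rewrite fmap_comp, H2; apply comp_id_l.
    - apply (comp_id_r (c := Pt E)).
    - reflexivity. }
  components U1 U1b U1t; components U2 U2b U2t.
  now exists (pt_total_map h).
Qed.

(** * Monomorphisms of points *)

(** The kernel pair of a map of points, computed levelwise. *)
Section KernelPair.
Variables (X Y : pt E) (w : X ⇒ Y).

Let kp_base := pb L (pt_base_map w) (pt_base_map w).
Let kp_total := pb L (pt_total_map w) (pt_total_map w).

Lemma pt_kernel_pair_proj_ok :
  pt_base_map w ∘ (proj X ∘ pb1 L (pt_total_map w) (pt_total_map w)) =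
  pt_base_map w ∘ (proj X ∘ pb2 L (pt_total_map w) (pt_total_map w)).
Proof.
  rw (eq_sym (pt_map_proj w)); rewrite (pb_comm L (pt_total_map w)).
  now rw (pt_map_proj w).
Qed.

Lemma pt_kernel_pair_sect_ok :
  pt_total_map w ∘ (sect X ∘ pb1 L (pt_base_map w) (pt_base_map w)) =
  pt_total_map w ∘ (sect X ∘ pb2 L (pt_base_map w) (pt_base_map w)).
Proof.
  rw (pt_map_sect w); rewrite (pb_comm L (pt_base_map w)).
  now rw (eq_sym (pt_map_sect w)).
Qed.

Lemma pt_kernel_pair_proj_sect :
  pb_lift L pt_kernel_pair_proj_ok ∘ pb_lift L pt_kernel_pair_sect_ok = idm kp_base.
Proof.
  apply (is_pullback_eq (pb_pullback L (pt_base_map w) (pt_base_map w))).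
  - rw (pb_lift1 L pt_kernel_pair_proj_ok);
      rw (pb_lift1 L pt_kernel_pair_sect_ok).
    rw (proj_sect X); now rewrite comp_id_l, comp_id_r.
  - rw (pb_lift2 L pt_kernel_pair_proj_ok);
      rw (pb_lift2 L pt_kernel_pair_sect_ok).
    rw (proj_sect X); now rewrite comp_id_l, comp_id_r.
Qed.

Definition pt_kernel_pair : pt E :=
  @PtObj E kp_base (@Point E kp_base kp_total _ _ pt_kernel_pair_proj_sect).

Definition pt_kernel_pair1 : pt_kernel_pair ⇒ X :=
  @PtHom E pt_kernel_pair X (pb1 L _ _) (pb1 L _ _)
    (eq_sym (pb_lift1 L pt_kernel_pair_proj_ok))
    (pb_lift1 L pt_kernel_pair_sect_ok).

Definition pt_kernel_pair2 : pt_kernel_pair ⇒ X :=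
  @PtHom E pt_kernel_pair X (pb2 L _ _) (pb2 L _ _)
    (eq_sym (pb_lift2 L pt_kernel_pair_proj_ok))
    (pb_lift2 L pt_kernel_pair_sect_ok).

Lemma pt_kernel_pair_comm : w ∘ pt_kernel_pair1 = w ∘ pt_kernel_pair2.
Proof. apply pt_hom_eq; cbn; apply pb_comm. Qed.

Lemma pt_kernel_pair_diag (U : pt E) (u : U ⇒ X) :
  exists d : U ⇒ pt_kernel_pair,
    pt_kernel_pair1 ∘ d = u /\ pt_kernel_pair2 ∘ d = u.
Proof.
  set (db := pb_lift L (eq_refl (pt_base_map w ∘ pt_base_map u))).
  set (dt := pb_lift L (eq_refl (pt_total_map w ∘ pt_total_map u))).
  assert (Hp : proj pt_kernel_pair ∘ dt = db ∘ proj U).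
  { apply (is_pullback_eq (pb_pullback L (pt_base_map w) (pt_base_map w))); cbn.
    - rw (pb_lift1 L pt_kernel_pair_proj_ok); unfold dt, db.
      now rw (pb_lift1 L (eq_refl (pt_total_map w ∘ pt_total_map u)));
      rw (pb_lift1 L (eq_refl (pt_base_map w ∘ pt_base_map u)));
      rewrite pt_map_proj.
    - rw (pb_lift2 L pt_kernel_pair_proj_ok); unfold dt, db.
      now rw (pb_lift2 L (eq_refl (pt_total_map w ∘ pt_total_map u)));
      rw (pb_lift2 L (eq_refl (pt_base_map w ∘ pt_base_map u)));
      rewrite pt_map_proj. }
  assert (Hs : dt ∘ sect U = sect pt_kernel_pair ∘ db).
  { apply (is_pullback_eq (pb_pullback L (pt_total_map w) (pt_total_map w))); cbn.
    - rw (pb_lift1 L pt_kernel_pair_sect_ok); unfold dt, db.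
      now rw (pb_lift1 L (eq_refl (pt_total_map w ∘ pt_total_map u)));
      rw (pb_lift1 L (eq_refl (pt_base_map w ∘ pt_base_map u)));
      rewrite pt_map_sect.
    - rw (pb_lift2 L pt_kernel_pair_sect_ok); unfold dt, db.
      now rw (pb_lift2 L (eq_refl (pt_total_map w ∘ pt_total_map u)));
      rw (pb_lift2 L (eq_refl (pt_base_map w ∘ pt_base_map u)));
      rewrite pt_map_sect. }
  exists (@PtHom E U pt_kernel_pair db dt Hp Hs).
  split; apply pt_hom_eq; cbn; first [apply pb_lift1 | apply pb_lift2].
Qed.

(** Two maps equalized by [w] at one of the two levels factor through the
    kernel pair there. *)
Lemma pt_kernel_pair_eq :
  pt_kernel_pair1 = pt_kernel_pair2 ->
  mono (pt_base_map w) /\ mono (pt_total_map w).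
Proof.
  intros H; components H Hb Ht; split; intros Z a b Hab.
  - rewrite <- (pb_lift1 L Hab), Hb at 1; apply pb_lift2.
  - rewrite <- (pb_lift1 L Hab), Ht at 1; apply pb_lift2.
Qed.

End KernelPair.

Lemma mono_of_levels (X Y : pt E) (w : X ⇒ Y) :
  mono (pt_base_map w) -> mono (pt_total_map w) -> mono w.
Proof.
  intros Mb Mt Z a b Hab; components Hab Hb Ht; apply pt_hom_eq; auto.
Qed.

Lemma mono_levels (X Y : pt E) (w : X ⇒ Y) :
  mono w -> mono (pt_base_map w) /\ mono (pt_total_map w).
Proof. intros M; apply pt_kernel_pair_eq, M, pt_kernel_pair_comm. Qed.

Lemma mono_cartesian (X Y : pt E) (f : X ⇒ Y) :
  PE_cartesian f -> mono (pt_base_map f) -> mono f.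
Proof.
  intros Cf Mb; apply mono_of_levels; trivial.
  apply cartesian_iff_pullback_square in Cf.
  exact (mono_pullback (is_pullback_sym Cf) Mb).
Qed.

(** * Extremal decompositions *)

(** The diagonal of [u] into the kernel pair of [w] is again cartesian, because
    a pair of elements of a fibre of [u] with the same image by [w] has the same
    image by the monomorphism [w ∘ u]. Both projections of the kernel pair thus
    compare the same competitor with the extremal decomposition. *)
Lemma extremal_mono (U X T : pt E) (v : U ⇒ T) (u : U ⇒ X) (w : X ⇒ T) :
  mono v -> is_extremal_decomposition (@PE_cartesian E) v u w -> mono w.
Proof.
  intros Mv (Hv & Cu & Ext).
  destruct (mono_levels Mv) as [_ Mvt]; components Hv Hvb Hvt.
  destruct (pt_kernel_pair_diag w u) as [d [H1 H2]].
  assert (Cd : PE_cartesian d).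
  { apply cartesian_iff_pullback_square in Cu.
    apply cartesian_iff_pullback_square.
    components H1 H1b H1t; components H2 H2b H2t.
    apply is_pullback_intro.
    - apply pt_map_proj.
    - intros W a b Hab.
      assert (Ha1 : proj X ∘ (pt_total_map (pt_kernel_pair1 w) ∘ a) =
                    pt_base_map u ∘ b).
      { rewrite comp_assoc, pt_map_proj, <- comp_assoc, Hab, comp_assoc; cbn.
        now rewrite H1b. }
      assert (Ha2 : proj X ∘ (pt_total_map (pt_kernel_pair2 w) ∘ a) =
                    pt_base_map u ∘ b).
      { rewrite comp_assoc, pt_map_proj, <- comp_assoc, Hab, comp_assoc; cbn.
        now rewrite H2b. }
      destruct (proj2 Cu _ _ _ Ha1) as [c1 [[H3 H4] _]].
      destruct (proj2 Cu _ _ _ Ha2) as [c2 [[H5 H6] _]].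
      assert (c1 = c2) as <-.
      { apply Mvt; rewrite Hvt, <- !comp_assoc, H3, H5, !comp_assoc; cbn.
        now rewrite (pb_comm L (pt_total_map w)). }
      exists c1; split; trivial.
      apply (is_pullback_eq (pb_pullback L (pt_total_map w) (pt_total_map w))).
      + rewrite comp_assoc; cbn; now rewrite H1t.
      + rewrite comp_assoc; cbn; now rewrite H2t.
    - intros W a b Ha Hb; apply (is_pullback_eq Cu); trivial.
      cbn in Ha; now rewrite <- H1t, <- !comp_assoc, Ha. }
  assert (Hd : v = (w ∘ pt_kernel_pair1 w) ∘ d)
    by now rewrite <- comp_assoc, H1.
  destruct (Ext _ d _ Hd Cd) as [t [_ Ut]].
  assert (E1 : t = pt_kernel_pair1 w) by now apply Ut.
  assert (E2 : t = pt_kernel_pair2 w)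
    by (apply Ut; split; trivial; symmetry; apply pt_kernel_pair_comm).
  destruct (@pt_kernel_pair_eq _ _ w) as [Mb Mt]; [congruence|].
  now apply mono_of_levels.
Qed.

End Points.

(** * Kernels *)

Section Kernels.
Variables (E : category) (L : finitely_complete E) (Q : quasi_pointed L).

Lemma from_zero_mono (X : E) (f : zero Q ~> X) : mono f.
Proof. intros Z a b _; apply to_zero_unique. Qed.

Definition zero_pt_hom (U : point (zero Q)) (T : pt E) (a : total U ~> total T)
    (H : proj T ∘ a = from_zero Q (base T) ∘ proj U) : PtObj U ⇒ T :=
  @PtHom E (PtObj U) T (from_zero Q (base T)) a H (from_zero_unique _ _).

Definition fibre_zero_hom (U V : point (zero Q)) (a : total U ~> total V) :
  point_hom U V := @PointHom E (zero Q) U V a (to_zero_unique _ _) (from_zero_unique _ _).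

Lemma zero_pt_hom_eq (U : point (zero Q)) (T : pt E) (a b : PtObj U ⇒ T) :
  pt_total_map a = pt_total_map b -> a = b.
Proof. intros H; apply pt_hom_eq; trivial; apply from_zero_unique. Qed.

Lemma cartesian_iff_kernel (U : point (zero Q)) (T : pt E) (u : PtObj U ⇒ T) :
  PE_cartesian u <->
  is_pullback (proj T) (from_zero Q (base T)) (pt_total_map u) (proj U).
Proof.
  rewrite (cartesian_iff_pullback_square L); unfold pullback_square.
  now rewrite (from_zero_unique (pt_base_map u) (from_zero Q (base T))).
Qed.

Definition kt_of_cartesian (U : point (zero Q)) (X : pt E) (u : PtObj U ⇒ X)
    (Cu : PE_cartesian u) : kt Q :=
  {| kt_pt := X; ker := total U; ker_incl := pt_total_map u; ker_zero := proj U;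
     ker_pullback := proj1 (cartesian_iff_kernel u) Cu |}.

Lemma ker_mono (X : kt Q) : mono (ker_incl X).
Proof.
  exact (mono_pullback (is_pullback_sym (ker_pullback X)) (@from_zero_mono _ _)).
Qed.

Lemma fibre_zero_mono (U V : point (zero Q)) (u : @hom (PtOver (zero Q)) U V) :
  mono u <-> mono (total_map u).
Proof.
  split; intros M Z a b Hab.
  - set (Z' := {| total := Z; proj := proj U ∘ a; sect := from_zero Q Z;
                  proj_sect := from_zero_unique _ _ |} : point (zero Q)).
    assert (H : fibre_zero_hom (U := Z') (V := U) a =
                fibre_zero_hom (U := Z') (V := U) b).
    { apply (M Z'), point_hom_eq, Hab. }
    exact (f_equal (@total_map _ _ _ _) H).
  - apply point_hom_eq, M; exact (f_equal (@total_map _ _ _ _) Hab).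
Qed.

Lemma fibre_zero_iso (U V : point (zero Q)) (u : @hom (PtOver (zero Q)) U V) :
  is_iso u -> is_iso (total_map u).
Proof.
  intros [g [H1 H2]]; exists (total_map g); split.
  - exact (f_equal (@total_map _ _ _ _) H1).
  - exact (f_equal (@total_map _ _ _ _) H2).
Qed.

(** ** Left exactness of the kernel functor *)

(** The left adjoint of the kernel functor: an object with a map to zero is its
    own kernel. *)
Definition free_kt (U : point (zero Q)) : kt Q.
Proof.
  refine (@KtObj E L Q (PtObj U) (total U) (idm (total U)) (proj U) _).
  apply (proj1 (cartesian_iff_kernel (idm (PtObj U : Pt E)))).
  intros Z g k Hk; exists g; split; [split|].
  - apply comp_id_l.
  - rewrite <- Hk; apply comp_id_l.
  - intros h [H _]; rewrite <- H; apply comp_id_l.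
Defined.

Lemma free_kt_hom_ok (U : point (zero Q)) (X : kt Q) (a : total U ~> ker X) :
  proj X ∘ (ker_incl X ∘ a) = from_zero Q (base X) ∘ proj U.
Proof.
  destruct (ker_pullback X) as [H _]; rw H; f_equal; apply to_zero_unique.
Qed.

Definition free_kt_hom (U : point (zero Q)) (X : kt Q) (a : total U ~> ker X) :
  @hom (Kt Q) (free_kt U) X :=
  @KtHom E L Q (free_kt U) X (zero_pt_hom (free_kt_hom_ok a)) a
    (eq_sym (comp_id_r _)).

Lemma free_kt_hom_eq (U : point (zero Q)) (X : kt Q)
    (a b : @hom (Kt Q) (free_kt U) X) : ker_map a = ker_map b -> a = b.
Proof.
  intros H; apply kt_hom_eq; trivial; apply zero_pt_hom_eq.
  pose proof (ker_map_incl a) as Ha; pose proof (ker_map_incl b) as Hb.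
  cbn in Ha, Hb; rewrite comp_id_r in Ha, Hb; congruence.
Qed.

(** The kernel functor is a right adjoint. *)
Lemma kernel_functor_left_exact : left_exact (kernel_functor Q).
Proof.
  split.
  - intros T HT U; destruct (HT (free_kt U)) as [h [_ Uh]].
    exists (fibre_zero_hom (V := kernel_point T) (ker_map h)); split; trivial.
    intros g _; apply point_hom_eq; cbn.
    exact (f_equal (@ker_map _ _ _ _ _) (Uh (free_kt_hom (total_map g)) I)).
  - intros X Y Z P f g p q [Sq U]; split.
    + now rewrite <- !fmap_comp, Sq.
    + intros W a b Hab.
      apply (f_equal (@total_map _ _ _ _)) in Hab; cbn in Hab.
      assert (H : f ∘ free_kt_hom (X := X) (total_map a) =
                  g ∘ free_kt_hom (X := Y) (total_map b))
        by now apply free_kt_hom_eq.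
      destruct (U (free_kt W) _ _ H) as [c [[H1 H2] Uc]].
      exists (fibre_zero_hom (V := kernel_point P) (ker_map c)).
      split; [split; apply point_hom_eq; cbn|].
      * exact (f_equal (@ker_map _ _ _ _ _) H1).
      * exact (f_equal (@ker_map _ _ _ _ _) H2).
      * intros d [H3 H4]; apply point_hom_eq; cbn.
        apply (f_equal (@total_map _ _ _ _)) in H3, H4; cbn in H3, H4.
        rewrite (Uc (free_kt_hom (X := P) (total_map d))); trivial.
        now split; apply free_kt_hom_eq.
Qed.

(** ** Pre-cartesian liftings as extremal decompositions *)

(** Decompositions of a map from an object over zero through a cartesian map
    are the same as split exact sequences over the codomain with that object as
    kernel. *)
Definition decomposable_over_zero : Prop :=
  forall (U : point (zero Q)) (T : pt E) (v : PtObj U ⇒ T), mono v ->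
  exists (X : pt E) (u : PtObj U ⇒ X) (w : X ⇒ T),
    is_extremal_decomposition (@PE_cartesian E) v u w.

Lemma kernel_hom_cartesian_of_iso (X : kt Q) (U : point (zero Q)) (j : total U ~> ker X) :
  is_iso j -> PE_cartesian (zero_pt_hom (free_kt_hom_ok j)).
Proof.
  intros I; apply cartesian_iff_kernel; cbn.
  rewrite (to_zero_unique (proj U) (ker_zero X ∘ j)).
  exact (is_pullback_iso (ker_pullback X) I).
Qed.

(** The middle object of the decomposition, with [U] as chosen kernel, is the
    lifting. A competitor [Z] has a kernel identified with [U], through which
    [U] maps to [Z] by a cartesian map. *)
Lemma pre_fibrant_of_decomposable :
  decomposable_over_zero -> pre_fibrant_on_monos (kernel_functor Q).
Proof.
  intros D; split; [exact kernel_functor_left_exact|].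
  intros T U u Mu; apply fibre_zero_mono in Mu.
  set (v := zero_pt_hom (free_kt_hom_ok (X := T) (total_map u))).
  assert (Mv : mono v).
  { apply mono_of_levels; [apply from_zero_mono | cbn].
    apply mono_comp; [apply ker_mono | exact Mu]. }
  destruct (D U T v Mv) as [X [c [w Ew]]].
  pose proof (extremal_mono L Mv Ew) as Mw.
  destruct Ew as (Hv & Cc & Ext).
  components Hv Hvb Hvt.
  set (w' := @KtHom E L Q (kt_of_cartesian Cc) T w (total_map u) Hvt
             : @hom (Kt Q) (kt_of_cartesian Cc) T).
  assert (Mw' : mono w').
  { intros Z a b Hab; apply (f_equal (@kt_pt_hom _ _ _ _ _)) in Hab.
    assert (H : kt_pt_hom a = kt_pt_hom b) by exact (Mw _ _ _ Hab).
    apply kt_hom_eq; trivial.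
    apply (ker_mono (X := kt_of_cartesian Cc)); now rewrite !ker_map_incl, H. }
  exists (kt_of_cartesian Cc), w',
    (fibre_zero_hom (U := kernel_point (kt_of_cartesian Cc)) (V := U)
       (idm (total U))).
  split; [exact Mw'|]; split; [|split].
  - intros Z g e He.
    pose proof (fibre_zero_iso (eq_hom_iso e)) as [i [Hi1 Hi2]].
    revert He Hi1 Hi2; generalize (eq_hom e); intros j He Hi1 Hi2.
    apply (f_equal (@total_map _ _ _ _)) in He; cbn in j, i, He, Hi1, Hi2.
    set (d := zero_pt_hom (free_kt_hom_ok (X := Z) (U := U) i)).
    assert (Cd : PE_cartesian d).
    { apply kernel_hom_cartesian_of_iso; now exists (total_map j). }
    assert (Hd : v = (kt_pt_hom g : Z ⇒ T) ∘ d).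
    { apply zero_pt_hom_eq; cbn; rw (eq_sym (ker_map_incl g)).
      rewrite He; rw Hi2; now rewrite comp_id_r. }
    destruct (Ext Z d (kt_pt_hom g) Hd Cd) as [t [[H1 H2] _]].
    components H2 H2b H2t.
    assert (Ht : pt_total_map c ∘ total_map j = pt_total_map t ∘ ker_incl Z).
    { rewrite <- H2t; rw Hi1; now rewrite comp_id_r. }
    set (t' := @KtHom E L Q Z (kt_of_cartesian Cc) t (total_map j) Ht
               : @hom (Kt Q) Z (kt_of_cartesian Cc)).
    assert (Hwt : w' ∘ t' = g) by now apply kt_hom_eq.
    exists t'; split; [split; trivial; now apply point_hom_eq|].
    intros h [H3 _]; apply Mw'; congruence.
  - exists (fibre_zero_hom (U := U) (V := kernel_point (kt_of_cartesian Cc))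
       (idm (total U))); split; apply point_hom_eq; apply comp_id_l.
  - apply point_hom_eq; apply comp_id_r.
Qed.

Lemma decomposable_of_pre_fibrant :
  pre_fibrant_on_monos (kernel_functor Q) -> decomposable_over_zero.
Proof.
  intros [_ P] U T v Mv.
  set (T' := {| kt_pt := T; ker := pb L (proj T) (from_zero Q (base T));
                ker_incl := pb1 L _ _; ker_zero := pb2 L _ _;
                ker_pullback := pb_pullback L _ _ |} : kt Q).
  assert (Hv : proj T ∘ pt_total_map v = from_zero Q (base T) ∘ proj U).
  { rewrite pt_map_proj; f_equal; apply from_zero_unique. }
  set (u := fibre_zero_hom (U := U) (V := kernel_point T') (pb_lift L Hv)
            : @hom (PtOver (zero Q)) U (kernel_functor Q T')).
  assert (Mu : mono u).
  { apply fibre_zero_mono, (mono_cancel (g := ker_incl T')); cbn.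
    rewrite pb_lift1; exact (proj2 (mono_levels L Mv)). }
  destruct (P T' U u Mu) as [X [w [i [_ [Pw [Ii Hi]]]]]].
  apply fibre_zero_iso in Ii; destruct Ii as [j [Hj1 Hj2]].
  apply (f_equal (@total_map _ _ _ _)) in Hi.
  cbn in Hi, i, j, Hj1, Hj2.
  set (c := zero_pt_hom (free_kt_hom_ok (X := X) (U := U) j)).
  assert (Cc : PE_cartesian c).
  { apply kernel_hom_cartesian_of_iso; now exists (total_map i). }
  exists (kt_pt X), c, (kt_pt_hom w); split; [|split; trivial].
  - apply zero_pt_hom_eq; cbn.
    rw (eq_sym (ker_map_incl w)); rewrite <- Hi; cbn.
    rw Hj2; rewrite comp_id_r; symmetry; apply pb_lift1.
  - intros X' u' w' Hw' Cu'; components Hw' Hwb Hwt.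
    (* Replacing the kernel of the competitor by the isomorphic kernel of [X]
       makes the two values of the kernel functor equal on the nose. *)
    set (k := zero_pt_hom (free_kt_hom_ok (X := kt_of_cartesian Cu')
                             (U := kernel_point X) (total_map i))).
    assert (Ck : PE_cartesian k).
    { apply kernel_hom_cartesian_of_iso; now exists j. }
    assert (Hg : ker_incl T' ∘ ker_map w =
                 pt_total_map w' ∘ ker_incl (kt_of_cartesian Ck)).
    { rewrite <- Hi; cbn.
      rw (pb_lift1 L Hv); rewrite Hwt; now rewrite <- comp_assoc. }
    set (g := @KtHom E L Q (kt_of_cartesian Ck) T' w' (ker_map w) Hg
              : @hom (Kt Q) (kt_of_cartesian Ck) T').
    destruct (Pw (kt_of_cartesian Ck) g eq_refl) as [t [[H1 H2] Ut]].
    { now apply point_hom_eq; symmetry; apply comp_id_r. }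
    apply (f_equal (@total_map _ _ _ _)) in H2; cbn in H2.
    exists (kt_pt_hom t); split; [split|].
    + exact (f_equal (@kt_pt_hom _ _ _ _ _) H1).
    + apply zero_pt_hom_eq; cbn.
      pose proof (ker_map_incl t) as Ht; cbn in Ht; rewrite H2 in Ht.
      rewrite comp_id_r in Ht; rewrite Ht, <- !comp_assoc, Hj2.
      now rewrite comp_id_r.
    + intros h [H3 H4]; components H4 H4b H4t.
      assert (Hh : ker_incl X ∘ idm (ker X) =
                   pt_total_map h ∘ ker_incl (kt_of_cartesian Ck)).
      { cbn; rewrite comp_assoc, H4t, <- comp_assoc, Hj1; reflexivity. }
      set (h' := @KtHom E L Q (kt_of_cartesian Ck) X h (idm (ker X)) Hh
                 : @hom (Kt Q) (kt_of_cartesian Ck) X).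
      rewrite (Ut h'); trivial; split; [|now apply point_hom_eq].
      apply kt_hom_eq; [exact H3 | apply comp_id_r].
Qed.

End Kernels.

(** * Protomodular categories *)

Section Protomodular.
Variables (E : category) (L : finitely_complete E).
Hypothesis PM : protomodular L.

(** If a map of points over [Y] induces an isomorphism between the pullbacks
    along some [y], here both presented by the same [P], then base change along
    [y] inverts it. *)
Lemma iso_of_common_pullback (Y Y' P : E) (p q : point Y) (a : point_hom p q)
    (y : Y' ~> Y) (g : P ~> total p) (h : P ~> Y') :
  is_pullback (proj p) y g h -> is_pullback (proj q) y (a ∘ g) h ->
  is_iso (total_map a).
Proof.
  intros Hp Hq.
  destruct (proj2 Hq _ _ _ (pb_comm L (proj q) y)) as [m [[H1 H2] _]].
  destruct (proj2 Hp _ _ _ (pb_comm L (proj p) y)) as [m' [[H1' H2'] _]].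
  assert (Hn : proj p ∘ (g ∘ m) = y ∘ pb2 L (proj q) y).
  { destruct Hp as [H _]; rw H; now rewrite H2. }
  set (bc := base_change_map L y a).
  set (n := pb_lift L Hn : total (base_change_obj L y q) ~>
                           total (base_change_obj L y p)).
  assert (R : total_map bc ∘ n = idm _).
  { apply (is_pullback_eq (pb_pullback L (proj q) y)); cbn.
    - rw (pb_lift1 L (base_change_map_comm L y a)); unfold n.
      rw (pb_lift1 L Hn); now rewrite comp_assoc, H1, comp_id_r.
    - rw (pb_lift2 L (base_change_map_comm L y a)); unfold n.
      now rewrite pb_lift2, comp_id_r. }
  assert (S : n ∘ total_map bc = idm _).
  { assert (Hm : m ∘ total_map bc = m').
    { apply (is_pullback_eq Hq); cbn.
      - rewrite comp_assoc, H1, pb_lift1; rw H1'; reflexivity.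
      - rw H2; now rewrite pb_lift2, H2'. }
    apply (is_pullback_eq (pb_pullback L (proj p) y)); cbn; unfold n.
    - rw (pb_lift1 L Hn); cbn in Hm; rewrite Hm, H1'; now rewrite comp_id_r.
    - rw (pb_lift2 L Hn); now rewrite pb_lift2, comp_id_r. }
  assert (Np : proj (base_change_obj L y p) ∘ n = proj (base_change_obj L y q))
    by apply pb_lift2.
  assert (Ns : n ∘ sect (base_change_obj L y q) = sect (base_change_obj L y p)).
  { rewrite <- (total_map_sect bc), comp_assoc, S; apply comp_id_l. }
  destruct (@PM Y Y' y p q a) as [b [H3 H4]].
  { exists (PointHom Np Ns); split; now apply point_hom_eq. }
  exists (total_map b); split.
  - exact (f_equal (@total_map _ _ _ _) H3).
  - exact (f_equal (@total_map _ _ _ _) H4).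
Qed.

(** The total object of a point is jointly covered by its section and by any
    pullback of it: the equalizer of two maps that agree on both is a subpoint
    with the same pullback. *)
Lemma jointly_epi (P X : pt E) (c : P ⇒ X) (W : E) (a b : total X ~> W) :
  PE_cartesian c ->
  a ∘ pt_total_map c = b ∘ pt_total_map c -> a ∘ sect X = b ∘ sect X -> a = b.
Proof.
  intros Cc Hc Hs; apply (cartesian_iff_pullback_square L) in Cc.
  set (ga := pair L (idm (total X)) a); set (gb := pair L (idm (total X)) b).
  assert (G : forall V (x y : V ~> total X), ga ∘ x = gb ∘ y ->
                x = y /\ a ∘ x = b ∘ y).
  { intros V x y H; split.
    - transitivity (prod1 L _ _ ∘ (ga ∘ x)); [|rewrite H]; unfold ga, gb.
      + rw (prod1_pair L (idm (total X)) a); now rewrite comp_id_l.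
      + rw (prod1_pair L (idm (total X)) b); now rewrite comp_id_l.
    - transitivity (prod2 L _ _ ∘ (ga ∘ x)); [|rewrite H]; unfold ga, gb.
      + now rw (prod2_pair L (idm (total X)) a).
      + now rw (prod2_pair L (idm (total X)) b). }
  assert (G' : forall V (x : V ~> total X), a ∘ x = b ∘ x -> ga ∘ x = gb ∘ x).
  { intros V x H; apply (is_pullback_eq (pb_pullback L _ _)).
    - unfold ga, gb; rw (prod1_pair L (idm (total X)) a).
      now rw (prod1_pair L (idm (total X)) b).
    - unfold ga, gb; rw (prod2_pair L (idm (total X)) a).
      now rw (prod2_pair L (idm (total X)) b). }
  set (e := pb1 L ga gb).
  assert (He : a ∘ e = b ∘ e).
  { destruct (G _ _ _ (pb_comm L ga gb)) as [H1 H2]; unfold e.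
    now rewrite H2, <- H1. }
  assert (Me : mono e).
  { intros V x y H; apply (is_pullback_eq (pb_pullback L ga gb)); trivial.
    destruct (G _ _ _ (pb_comm L ga gb)) as [H1 _]; now rewrite <- H1. }
  assert (S1 : e ∘ pb_lift L (G' _ _ Hs) = sect X) by apply pb_lift1.
  assert (M1 : proj X ∘ e ∘ pb_lift L (G' _ _ Hs) = idm _)
    by (rewrite <- comp_assoc, S1; apply proj_sect).
  set (m := Point M1).
  set (e' := @PointHom E (base X) m X e eq_refl S1).
  assert (Hg : e ∘ pb_lift L (G' _ _ Hc) = pt_total_map c) by apply pb_lift1.
  assert (I : is_iso (total_map e')).
  { apply iso_of_common_pullback with (y := pt_base_map c)
      (g := pb_lift L (G' _ _ Hc)) (h := proj P).
    - apply is_pullback_intro; cbn.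
      + rw Hg; apply pt_map_proj.
      + intros V x y H; rewrite <- comp_assoc in H.
        destruct (proj2 Cc _ _ _ H) as [z [[H1 H2] _]].
        exists z; split; trivial; apply Me; now rw Hg.
      + intros V x y H1 H2; apply (is_pullback_eq Cc); trivial.
        rewrite <- Hg, <- !comp_assoc; now rewrite H1.
    - cbn; rewrite Hg; exact Cc. }
  destruct I as [r [_ Hr]]; cbn in Hr.
  now rewrite <- (comp_id_r a), <- (comp_id_r b), <- Hr, !comp_assoc, He.
Qed.

(** Right cancellation: the comparison of [X] with the base change of [Z] along
    [u] becomes an isomorphism over the base of [c]. *)
Lemma cartesian_cancel_right (P X Z : pt E) (c : P ⇒ X) (u : X ⇒ Z) :
  PE_cartesian c -> PE_cartesian (u ∘ c) -> PE_cartesian u.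
Proof.
  intros Cc Cuc.
  assert (Ck : PE_cartesian (comparison L u ∘ c)).
  { apply (cartesian_cancel (g := base_change_pt_proj L u)).
    - apply base_change_pt_cartesian.
    - now rewrite comp_assoc, comparison_factor. }
  apply (cartesian_iff_pullback_square L) in Cc, Ck.
  apply (cartesian_iff_pullback_square L).
  apply (pullback_square_of_comparison_iso (L := L)).
  apply (iso_of_common_pullback (a := comparison_point_hom L u) Cc).
  unfold pullback_square in Ck; cbn in Ck; now rewrite comp_id_l in Ck.
Qed.

(** * Reduction to objects over zero *)

(** A decomposition of [v] is extremal as soon as its restriction along a
    cartesian map is: the comparison maps are the same, since [w] is a
    monomorphism. *)
Lemma extremal_of_restriction (P U X T : pt E) (c : P ⇒ U) (v : U ⇒ T)
    (u : U ⇒ X) (w : X ⇒ T) :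
  PE_cartesian c -> mono (v ∘ c) -> v = w ∘ u -> PE_cartesian u ->
  is_extremal_decomposition (@PE_cartesian E) (v ∘ c) (u ∘ c) w ->
  is_extremal_decomposition (@PE_cartesian E) v u w.
Proof.
  intros Cc Mvc Hv Cu Ew; pose proof (extremal_mono L Mvc Ew) as Mw.
  destruct Ew as (_ & _ & Ext); split; [|split]; trivial.
  intros X' u' w' Hv' Cu'.
  destruct (Ext X' (u' ∘ c) w') as [t [[H1 H2] _]].
  - now rewrite Hv', comp_assoc.
  - exact (cartesian_comp Cu' Cc).
  - exists t; split; [split; trivial|].
    + apply Mw; now rewrite comp_assoc, H1, <- Hv', <- Hv.
    + intros s [H3 _]; apply Mw; congruence.
Qed.

(** The second component of an extremal decomposition is the largest one, so a
    decomposition by a monomorphism into which it maps is extremal too. *)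
Lemma extremal_transport (U X X' T : pt E) (v : U ⇒ T) (u : U ⇒ X)
    (w : X ⇒ T) (u' : U ⇒ X') (w' : X' ⇒ T) (t : X ⇒ X') :
  is_extremal_decomposition (@PE_cartesian E) v u w ->
  v = w' ∘ u' -> PE_cartesian u' -> mono w' -> w' ∘ t = w ->
  is_extremal_decomposition (@PE_cartesian E) v u' w'.
Proof.
  intros (Hv & _ & Ext) Hv' Cu' Mw' Ht; split; [|split]; trivial.
  intros Y b z Hz Cb; destruct (Ext Y b z Hz Cb) as [r [[H1 H2] _]].
  exists (t ∘ r); split; [split|].
  - now rewrite comp_assoc, Ht.
  - apply Mw'; rewrite !comp_assoc, Ht, <- Hv', Hv, <- H2.
    now rewrite <- comp_assoc.
  - intros s [H3 _]; apply Mw'; now rewrite comp_assoc, Ht, H1, H3.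
Qed.

Variable Q : quasi_pointed L.

Definition kernel_pt (X : pt E) : point (zero Q) :=
  base_change_obj L (from_zero Q (base X)) X.

Definition kernel_pt_incl (X : pt E) : PtObj (kernel_pt X) ⇒ X :=
  zero_pt_hom (U := kernel_pt X) (T := X) (pb_comm L _ _).

Lemma kernel_pt_incl_cartesian (X : pt E) : PE_cartesian (kernel_pt_incl X).
Proof. apply cartesian_iff_kernel, pb_pullback. Qed.

Lemma kernel_pt_incl_mono (X : pt E) : mono (kernel_pt_incl X).
Proof.
  apply (mono_cartesian L (@kernel_pt_incl_cartesian X)), from_zero_mono.
Qed.

(** An extremal decomposition [w ∘ u0] of the restriction of [v] along a
    cartesian map [c] extends to [v]: [v] itself competes with [w], which gives [u] with
    [u ∘ c = u0], cartesian by right cancellation. *)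
Lemma extend_restriction (P U X T : pt E) (c : P ⇒ U) (v : U ⇒ T)
    (u0 : P ⇒ X) (w : X ⇒ T) :
  PE_cartesian c ->
  is_extremal_decomposition (@PE_cartesian E) (v ∘ c) u0 w ->
  exists u : U ⇒ X, v = w ∘ u /\ u ∘ c = u0 /\ PE_cartesian u.
Proof.
  intros Cc (_ & Cu0 & Ext).
  destruct (Ext U c v eq_refl Cc) as [u [[H1 H2] _]].
  exists u; split; [|split]; trivial; [now symmetry|].
  apply (cartesian_cancel_right Cc); now rewrite H2.
Qed.

Lemma decomposable_of_over_zero : decomposable_over_zero Q -> P_decomposable E.
Proof.
  intros D U T v Mv; pose proof (@kernel_pt_incl_cartesian U) as Cc.
  pose proof (mono_comp Mv (@kernel_pt_incl_mono U)) as Mvc.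
  destruct (D _ _ _ Mvc) as [X [u0 [w Ew]]].
  destruct (extend_restriction Cc Ew) as [u [Hv [Hu Cu]]].
  exists X, u, w; apply (extremal_of_restriction Cc); trivial; now rewrite Hu.
Qed.

(** Conversely, extremality restricts along cartesian maps: the extremal
    decomposition of the restriction extends to the whole of [v], hence its
    second component factors through [w]. *)
Lemma restriction_extremal (P U X T : pt E) (c : P ⇒ U) (v : U ⇒ T)
    (u : U ⇒ X) (w : X ⇒ T) :
  P_decomposable E -> PE_cartesian c -> mono c -> mono v ->
  is_extremal_decomposition (@PE_cartesian E) v u w ->
  is_extremal_decomposition (@PE_cartesian E) (v ∘ c) (u ∘ c) w.
Proof.
  intros D Cc Mc Mv Ew; pose proof (extremal_mono L Mv Ew) as Mw.
  destruct (D _ _ _ (mono_comp Mv Mc)) as [X1 [u1 [w1 E1]]].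
  destruct (extend_restriction Cc E1) as [m [H1 [_ Cm]]].
  destruct Ew as (Hv & Cu & Ext).
  destruct (Ext X1 m w1 H1 Cm) as [t [[Ht _] _]].
  refine (extremal_transport E1 _ (cartesian_comp Cu Cc) Mw Ht).
  now rewrite Hv, comp_assoc.
Qed.

(** A competitor over [T'], restricted to the kernel of [U'], becomes after
    composition with [th] a competitor for the restriction of [v] to the same
    object, which is also the kernel of [U] since [a] is cartesian. The
    resulting comparison map lifts to the pullback [X']. *)
Lemma extremal_stable :
  P_decomposable E -> extremal_decompositions_stable (@PE_cartesian E).
Proof.
  intros D U X T v u w Mv Ew T' th Cth X' b w' PB1 U' a u' PB2.
  pose proof (extremal_mono L Mv Ew) as Mw.
  pose proof (mono_pullback PB1 Mw) as Mw'.
  pose proof (cartesian_pullback (is_pullback_sym PB1) Cth) as Cb.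
  pose proof (cartesian_pullback (is_pullback_sym PB2) Cb) as Ca.
  pose proof Ew as (Hv & Cu & _).
  split; [reflexivity | split; [exact (cartesian_pullback PB2 Cu)|]].
  intros X2 u2 w2 H2 Cu2.
  set (c := kernel_pt_incl U').
  assert (Cc : PE_cartesian c) by apply kernel_pt_incl_cartesian.
  assert (Mac : mono (a ∘ c)).
  { apply (mono_cartesian L (cartesian_comp Ca Cc)), from_zero_mono. }
  pose proof (restriction_extremal D (cartesian_comp Ca Cc) Mac Mv Ew)
    as (_ & _ & Ext).
  assert (Hd : v ∘ (a ∘ c) = (th ∘ w2) ∘ (u2 ∘ c)).
  { rw (eq_sym H2); rw (eq_sym (proj1 PB1)); rw (eq_sym (proj1 PB2)).
    now rewrite Hv, <- comp_assoc. }
  destruct (Ext X2 (u2 ∘ c) (th ∘ w2) Hd (cartesian_comp Cu2 Cc))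
    as [h [[H3 _] _]].
  destruct (proj2 PB1 X2 h w2 H3) as [t [[_ H4] _]].
  exists t; split; [split; trivial|].
  - apply Mw'; now rewrite comp_assoc, H4, <- H2.
  - intros s [H5 _]; apply Mw'; congruence.
Qed.

End Protomodular.

(** * Equivalence relations as points *)

Section Relations.
Variables (E : category) (L : finitely_complete E).

Lemma prod_eq (X Y W : E) (a b : W ~> prod L X Y) :
  prod1 L X Y ∘ a = prod1 L X Y ∘ b -> prod2 L X Y ∘ a = prod2 L X Y ∘ b ->
  a = b.
Proof. apply (is_pullback_eq (pb_pullback L _ _)). Qed.

Lemma refl_sect_exists (X : E) (R : equiv_relation X) :
  exists! r : X ~> R, d0 R ∘ r = idm X /\ d1 R ∘ r = idm X.
Proof.
  destruct (@Equivalence_Reflexive _ _ (equiv_rel_equivalence R X) (idm X))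
    as [r [H0 H1]].
  exists r; split; [now split|]; intros s [H2 H3].
  apply (d_jointly_mono (r := R)); congruence.
Qed.

Definition refl_sect (X : E) (R : equiv_relation X) : X ~> R :=
  the (refl_sect_exists R).

Lemma refl_sect0 (X : E) (R : equiv_relation X) : d0 R ∘ refl_sect R = idm X.
Proof. exact (proj1 (the_spec (refl_sect_exists R))). Qed.

Lemma refl_sect1 (X : E) (R : equiv_relation X) : d1 R ∘ refl_sect R = idm X.
Proof. exact (proj2 (the_spec (refl_sect_exists R))). Qed.

(** The fibre over an element is its equivalence class. *)
Definition rel_pt (X : E) (R : equiv_relation X) : pt E :=
  @PtObj E X (@Point E X R (d0 R) (refl_sect R) (refl_sect0 R)).

Section RelHom.
Variables (X X' : E) (R : equiv_relation X) (R' : equiv_relation X').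
Variables (g : X ~> X') (t : R ~> R').
Hypotheses (H0 : d0 R' ∘ t = g ∘ d0 R) (H1 : d1 R' ∘ t = g ∘ d1 R).

Lemma rel_pt_hom_sect : t ∘ refl_sect R = refl_sect R' ∘ g.
Proof.
  apply (d_jointly_mono (r := R')).
  - rw H0; rw (refl_sect0 R); rw (refl_sect0 R').
    now rewrite comp_id_l, comp_id_r.
  - rw H1; rw (refl_sect1 R); rw (refl_sect1 R').
    now rewrite comp_id_l, comp_id_r.
Qed.

Definition rel_pt_hom : rel_pt R ⇒ rel_pt R' :=
  @PtHom E (rel_pt R) (rel_pt R') g t H0 rel_pt_hom_sect.

End RelHom.

Definition kernel_rel (X Y : E) (f : X ~> Y) : relation X :=
  {| rel_obj := pb L f f; d0 := pb1 L f f; d1 := pb2 L f f;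
     d_jointly_mono := is_pullback_eq (pb_pullback L f f) |}.

Lemma related_kernel_rel (X Y : E) (f : X ~> Y) (W : E) (a b : W ~> X) :
  related (kernel_rel f) a b <-> f ∘ a = f ∘ b.
Proof.
  split.
  - intros [r [<- <-]]; cbn; rewrite !comp_assoc; now rewrite pb_comm.
  - intros H; exists (pb_lift L H); split; [apply pb_lift1 | apply pb_lift2].
Qed.

Definition kernel_equiv (X Y : E) (f : X ~> Y) : equiv_relation X.
Proof.
  refine (@EquivRelation E X (kernel_rel f) _); intros W; split.
  - intros a; now apply related_kernel_rel.
  - intros a b; rewrite !related_kernel_rel; congruence.
  - intros a b c; rewrite !related_kernel_rel; congruence.
Defined.

Definition nabla_equiv (U : E) : equiv_relation U := kernel_equiv (to_one L U).

Lemma equivalence_of_euclidean (X : E) (R : relation X) :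
  (forall W (a : W ~> X), related R a a) ->
  (forall W (a b c : W ~> X), related R a b -> related R a c ->
     related R b c) ->
  forall W, Equivalence (@related E X R W).
Proof.
  intros Refl Eucl W; split.
  - exact (Refl W).
  - intros a b H; exact (Eucl _ _ _ _ H (Refl _ a)).
  - intros a b c H1 H2; exact (Eucl _ _ _ _ (Eucl _ _ _ _ H1 (Refl _ a)) H2).
Qed.

Lemma rel_incl_inverse_image (X X' : E) (R' : relation X') (t : X' ~> X)
    (R : relation X) :
  rel_incl R' (inverse_image L t R) <->
  exists s : R' ~> R, d0 R ∘ s = t ∘ d0 R' /\ d1 R ∘ s = t ∘ d1 R'.
Proof.
  split.
  - intros [i [H0 H1]]; cbn in i, H0, H1.
    set (tt := prod_map L t t) in *; set (dd := pair L (d0 R) (d1 R)) in *.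
    assert (H : dd ∘ (pb2 L tt dd ∘ i) = tt ∘ (pb1 L tt dd ∘ i)).
    { now rewrite comp_assoc, <- pb_comm, comp_assoc. }
    exists (pb2 L tt dd ∘ i); split.
    + rewrite <- (prod1_pair L (d0 R) (d1 R)), <- comp_assoc; fold dd.
      rewrite H; unfold tt, prod_map; rewrite <- H0.
      now rw (prod1_pair L (t ∘ prod1 L X' X') (t ∘ prod2 L X' X')).
    + rewrite <- (prod2_pair L (d0 R) (d1 R)), <- comp_assoc; fold dd.
      rewrite H; unfold tt, prod_map; rewrite <- H1.
      now rw (prod2_pair L (t ∘ prod1 L X' X') (t ∘ prod2 L X' X')).
  - intros [s [H0 H1]].
    assert (H : prod_map L t t ∘ pair L (d0 R') (d1 R') =
                pair L (d0 R) (d1 R) ∘ s).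
    { unfold prod_map; apply prod_eq; rewrite !comp_assoc.
      - rewrite !prod1_pair, <- comp_assoc, prod1_pair; now symmetry.
      - rewrite !prod2_pair, <- comp_assoc, prod2_pair; now symmetry. }
    exists (pb_lift L H); cbn; split; rewrite <- comp_assoc, pb_lift1.
    + apply prod1_pair.
    + apply prod2_pair.
Qed.

(** The internal functor [phi] already relates the images of any two elements
    of [U], which is what the condition on the inverse image says. *)
Lemma normal_to_intro (U X : E) (u : U ~> X) (R : equiv_relation X)
    (phi : nabla L U ~> R) :
  mono u -> d0 R ∘ phi = u ∘ d0 (nabla L U) ->
  d1 R ∘ phi = u ∘ d1 (nabla L U) ->
  is_pullback (d0 R) u phi (d0 (nabla L U)) -> normal_to L u R.
Proof.
  intros Mu H0 H1 PB; split; [trivial | split; [split|]].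
  - exists (pair L (d0 (inverse_image L u R)) (d1 (inverse_image L u R))).
    split; [apply prod1_pair | apply prod2_pair].
  - apply rel_incl_inverse_image; now exists phi.
  - now exists phi.
Qed.

Lemma normal_to_cartesian (U X : E) (u : U ~> X) (R : equiv_relation X) :
  normal_to L u R ->
  exists phi : rel_pt (nabla_equiv U) ⇒ rel_pt R,
    pt_base_map phi = u /\ PE_cartesian phi /\
    d1 R ∘ pt_total_map phi = u ∘ d1 (nabla L U).
Proof.
  intros (_ & _ & phi & H0 & H1 & PB).
  exists (@rel_pt_hom _ _ (nabla_equiv U) R u phi H0 H1); split; [|split]; trivial.
  now apply (cartesian_iff_pullback_square L).
Qed.

(** * Normalizers from extremal decompositions *)

(** The normalizer of [v] comes from the extremal decomposition of the map of
    points [nabla v], given by [v] and [v * v]. Its middle object [X] has as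
    elements over [x] the [t] in [T] that belong to the class of [x]; that such
    [t] are again in the base of [X] follows by comparing the decomposition
    with a second one, whose middle object is based on the total object of
    [X], with the pairs [(x, t), (x, t')] as elements over [(x, t)], sent to
    [(t, t')]. *)
Section NormalizerOfDecomposition.
Variables (U T : E) (v : U ~> T).
Hypothesis Mv : mono v.

Definition nabla_map : rel_pt (nabla_equiv U) ⇒ rel_pt (nabla_equiv T) :=
  @rel_pt_hom _ _ (nabla_equiv U) (nabla_equiv T) v (prod_map L v v)
    (prod1_pair L _ _) (prod2_pair L _ _).

Lemma nabla_map_mono : mono nabla_map.
Proof.
  apply mono_of_levels; trivial; intros W a b H.
  apply prod_eq; apply Mv; rewrite !comp_assoc.
  - rewrite <- (prod1_pair L (v ∘ prod1 L U U) (v ∘ prod2 L U U)).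
    rewrite <- !comp_assoc; f_equal; exact H.
  - rewrite <- (prod2_pair L (v ∘ prod1 L U U) (v ∘ prod2 L U U)).
    rewrite <- !comp_assoc; f_equal; exact H.
Qed.

Variables (X : pt E) (u : rel_pt (nabla_equiv U) ⇒ X).
Variable w : X ⇒ rel_pt (nabla_equiv T).
Hypothesis Ew : is_extremal_decomposition (@PE_cartesian E) nabla_map u w.

Let delta : total X ~> T := prod2 L T T ∘ pt_total_map w.

Lemma normalizer_base_mono : mono (pt_base_map w).
Proof.
  exact (proj1 (mono_levels L (extremal_mono L nabla_map_mono Ew))).
Qed.

Lemma normalizer_total_mono : mono (pt_total_map w).
Proof.
  exact (proj2 (mono_levels L (extremal_mono L nabla_map_mono Ew))).
Qed.

Lemma normalizer_factor :
  pt_base_map w ∘ pt_base_map u = v /\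
  delta ∘ pt_total_map u = v ∘ prod2 L U U.
Proof.
  destruct Ew as (H & _ & _); components H Hb Ht; split; [now symmetry|].
  unfold delta; rewrite <- comp_assoc.
  transitivity (prod2 L T T ∘ prod_map L v v); [|apply prod2_pair].
  f_equal; now symmetry.
Qed.

Lemma normalizer_sect : delta ∘ sect X = pt_base_map w.
Proof.
  unfold delta; rewrite <- comp_assoc.
  transitivity (prod2 L T T ∘ (refl_sect (nabla_equiv T) ∘ pt_base_map w)).
  - f_equal; exact (pt_map_sect w).
  - transitivity (idm T ∘ pt_base_map w); [|apply comp_id_l].
    rewrite comp_assoc; f_equal; exact (refl_sect1 (nabla_equiv T)).
Qed.

Lemma normalizer_first :
  prod1 L T T ∘ pt_total_map w = pt_base_map w ∘ proj X.
Proof. exact (pt_map_proj w). Qed.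

(** The map [e], from [(x, t)] to [t], and the statement that [(x, t)] and
    [(x, t')] in the relation imply [(t, t')] in it: together they are the
    comparison with the second decomposition. *)
Lemma normalizer_second :
  exists (e : total X ~> base X) (t : pb L (proj X) (proj X) ~> total X),
    pt_base_map w ∘ e = delta /\
    proj X ∘ t = e ∘ pb1 L _ _ /\ e ∘ t = e ∘ pb2 L _ _.
Proof.
  destruct normalizer_factor as [Hvb Hvt].
  pose proof Ew as (_ & Cu & Ext).
  apply (cartesian_iff_pullback_square L) in Cu.
  set (K := kernel_equiv (proj X)).
  assert (H : proj X ∘ (sect X ∘ (pt_base_map u ∘ prod1 L U U)) =
              proj X ∘ pt_total_map u).
  { rw (proj_sect X); rewrite comp_id_l; symmetry; exact (pt_map_proj u). }
  assert (Hp : d0 K ∘ pb_lift L H = (sect X ∘ pt_base_map u) ∘ prod1 L U U)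
    by (rewrite <- comp_assoc; apply pb_lift1).
  assert (Hs : pb_lift L H ∘ refl_sect (nabla_equiv U) =
               refl_sect K ∘ (sect X ∘ pt_base_map u)).
  { apply (d_jointly_mono (r := K)).
    - rw (refl_sect0 K); rewrite comp_id_l, comp_assoc.
      transitivity ((sect X ∘ pt_base_map u ∘ prod1 L U U) ∘
                    refl_sect (nabla_equiv U)); [f_equal; exact Hp|].
      rewrite <- comp_assoc, <- (comp_id_r (sect X ∘ pt_base_map u)).
      rewrite <- comp_assoc; f_equal; f_equal.
      rewrite comp_id_l; exact (refl_sect0 (nabla_equiv U)).
    - rw (refl_sect1 K); rewrite comp_id_l.
      cbn; rw (pb_lift2 L H); exact (pt_map_sect u). }
  set (u' := @PtHom E (rel_pt (nabla_equiv U)) (rel_pt K) _ _ Hp Hs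
             : rel_pt (nabla_equiv U) ⇒ rel_pt K).
  assert (Cu' : PE_cartesian u').
  { apply (cartesian_iff_pullback_square L), is_pullback_intro.
    - exact Hp.
    - cbn; intros W a b Hab.
      assert (Ha : proj X ∘ (pb2 L _ _ ∘ a) = pt_base_map u ∘ b).
      { rewrite comp_assoc, <- pb_comm, <- comp_assoc, Hab; rw (proj_sect X).
        apply comp_id_l. }
      destruct (proj2 Cu _ _ _ Ha) as [c [[H1 H2] _]]; cbn in H2.
      exists c; split; trivial; apply (d_jointly_mono (r := K)); cbn.
      + rw (pb_lift1 L H); rewrite Hab, <- H2, <- comp_assoc; reflexivity.
      + now rw (pb_lift2 L H).
    - cbn; intros W a b H1 H2; apply (is_pullback_eq Cu); trivial.
      rewrite <- (pb_lift2 L H), <- !comp_assoc; f_equal; exact H1. }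
  set (w' := @rel_pt_hom _ _ K (nabla_equiv T) delta
               (pair L (delta ∘ d0 K) (delta ∘ d1 K))
               (prod1_pair L _ _) (prod2_pair L _ _)).
  assert (Hd : nabla_map = w' ∘ u').
  { apply pt_hom_eq; cbn.
    - rewrite comp_assoc, normalizer_sect; now symmetry.
    - unfold prod_map; apply prod_eq.
      + transitivity ((delta ∘ d0 K) ∘ pb_lift L H).
        * rewrite prod1_pair, <- comp_assoc.
          transitivity (delta ∘ (sect X ∘ pt_base_map u ∘ prod1 L U U)).
          -- rewrite !comp_assoc, normalizer_sect; f_equal; now symmetry.
          -- f_equal; symmetry; exact Hp.
        * rewrite comp_assoc; f_equal; symmetry; apply prod1_pair.
      + transitivity ((delta ∘ d1 K) ∘ pb_lift L H).
        * rewrite prod2_pair, <- comp_assoc, <- Hvt; f_equal; symmetry.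
          apply pb_lift2.
        * rewrite comp_assoc; f_equal; symmetry; apply prod2_pair. }
  destruct (Ext _ u' w' Hd Cu') as [t [[H1 _] _]]; components H1 H1b H1t.
  exists (pt_base_map t), (pt_total_map t); split; [|split]; trivial.
  - exact (pt_map_proj t).
  - apply normalizer_base_mono; rewrite !comp_assoc; cbn; rewrite H1b.
    transitivity (prod2 L T T ∘ pt_total_map w'); [|apply prod2_pair].
    unfold delta at 1; rewrite <- comp_assoc; f_equal; exact H1t.
Qed.

Lemma normalizer_of_decomposition : has_normalizer L v.
Proof.
  destruct normalizer_factor as [Hvb Hvt].
  destruct normalizer_second as [e [t [He [Ht0 Ht1]]]].
  pose proof normalizer_base_mono as Mw.
  pose proof Ew as (_ & Cu & Ext).
  assert (JM : forall W (a b : W ~> total X),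
             proj X ∘ a = proj X ∘ b -> e ∘ a = e ∘ b -> a = b).
  { intros W a b H0 H1; apply normalizer_total_mono, prod_eq; rewrite !comp_assoc.
    - transitivity (pt_base_map w ∘ proj X ∘ a);
        [f_equal; exact normalizer_first|].
      transitivity (pt_base_map w ∘ proj X ∘ b);
        [now rewrite <- !comp_assoc, H0 | f_equal; symmetry].
      exact normalizer_first.
    - transitivity (pt_base_map w ∘ e ∘ a); [f_equal; now symmetry|].
      transitivity (pt_base_map w ∘ e ∘ b);
        [now rewrite <- !comp_assoc, H1 | f_equal; exact He]. }
  set (R := @Relation E (base X) (total X) (proj X) e JM).
  assert (Hes : e ∘ sect X = idm (base X)).
  { apply Mw; rewrite comp_assoc, He, comp_id_r; exact normalizer_sect. }
  assert (Eq : forall W, Equivalence (@related E (base X) R W)).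
  { apply equivalence_of_euclidean.
    - intros W a; exists (sect X ∘ a); cbn; split; rewrite comp_assoc.
      + rewrite proj_sect; apply comp_id_l.
      + rewrite Hes; apply comp_id_l.
    - intros W a b c [r [Hr0 Hr1]] [s [Hs0 Hs1]]; cbn in r, s, Hr0, Hr1, Hs0, Hs1.
      assert (H : proj X ∘ r = proj X ∘ s) by congruence.
      exists (t ∘ pb_lift L H); cbn; split.
      + rw Ht0; now rewrite pb_lift1.
      + rw Ht1; now rewrite pb_lift2. }
  assert (Hphi : e ∘ pt_total_map u = pt_base_map u ∘ prod2 L U U).
  { apply Mw; rewrite !comp_assoc.
    transitivity (delta ∘ pt_total_map u); [f_equal; exact He|].
    transitivity (v ∘ prod2 L U U); [exact Hvt | f_equal; now symmetry]. }
  exists (base X), (pt_base_map u), (@EquivRelation E (base X) R Eq),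
    (pt_base_map w).
  split; [|split; [now symmetry|]].
  - apply normal_to_intro with (phi := pt_total_map u).
    + pose proof Mv as M; rewrite <- Hvb in M; exact (mono_cancel M).
    + exact (pt_map_proj u).
    + exact Hphi.
    + exact (proj1 (cartesian_iff_pullback_square L u) Cu).
  - intros X' u' S w' N Hv'.
    destruct (normal_to_cartesian N) as [phi [Hb [Cphi Ht]]].
    set (z := @rel_pt_hom _ _ S (nabla_equiv T) w'
               (pair L (w' ∘ d0 S) (w' ∘ d1 S))
               (prod1_pair L _ _) (prod2_pair L _ _)).
    assert (Hd : nabla_map = z ∘ phi).
    { apply pt_hom_eq; cbn.
      - now rewrite Hb.
      - unfold prod_map; apply prod_eq.
        + transitivity ((w' ∘ d0 S) ∘ pt_total_map phi).
          * rewrite prod1_pair, <- comp_assoc.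
            transitivity (w' ∘ (u' ∘ prod1 L U U)).
            -- now rewrite comp_assoc, <- Hv'.
            -- f_equal; symmetry; rewrite <- Hb; exact (pt_map_proj phi).
          * rewrite comp_assoc; f_equal; symmetry; apply prod1_pair.
        + transitivity ((w' ∘ d1 S) ∘ pt_total_map phi).
          * rewrite prod2_pair, <- comp_assoc.
            transitivity (w' ∘ (u' ∘ prod2 L U U)).
            -- now rewrite comp_assoc, <- Hv'.
            -- f_equal; symmetry; exact Ht.
          * rewrite comp_assoc; f_equal; symmetry; apply prod2_pair. }
    destruct (Ext _ phi z Hd Cphi) as [h [[H1 H2] _]].
    components H1 H1b H1t; components H2 H2b H2t.
    exists (pt_base_map h); split; [split; [|split]|].
    + exact H1b.
    + congruence.
    + apply rel_incl_inverse_image; exists (pt_total_map h); split.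
      * exact (pt_map_proj h).
      * apply Mw; rewrite !comp_assoc.
        transitivity (delta ∘ pt_total_map h); [f_equal; exact He|].
        transitivity (w' ∘ d1 S); [|f_equal; symmetry; exact H1b].
        transitivity (prod2 L T T ∘ pt_total_map z); [|apply prod2_pair].
        unfold delta; rewrite <- comp_assoc; f_equal; exact H1t.
    + intros s [H3 _]; apply Mw; exact (eq_trans H1b (eq_sym H3)).
Qed.

End NormalizerOfDecomposition.
End Relations.

(** * Extremal decompositions from normalizers *)

Section FromNormalizers.
Variables (E : category) (L : finitely_complete E) (Q : quasi_pointed L).

Lemma cartesian_eq (X Y Z : pt E) (f : Y ⇒ Z) (a b : X ⇒ Y) :
  PE_cartesian f -> f ∘ a = f ∘ b -> pt_base_map a = pt_base_map b -> a = b.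
Proof.
  intros Cf H Hb.
  destruct (Cf X (f ∘ b) (pt_base_map b) eq_refl) as [c [_ Uc]].
  transitivity c; [symmetry|]; now apply Uc.
Qed.

(** With [s] the section of [X], the base map of [a] is recovered as
    [d1 ∘ a ∘ s], because [d1] retracts the diagonal; and the base map determines
    the other component [d0 ∘ a]. *)
Lemma rel_pt_eq (X : pt E) (N : E) (R : equiv_relation N) (a b : X ⇒ rel_pt R) :
  d1 R ∘ pt_total_map a = d1 R ∘ pt_total_map b -> a = b.
Proof.
  intros H.
  assert (S : forall c : X ⇒ rel_pt R,
             d1 R ∘ (pt_total_map c ∘ sect X) = pt_base_map c).
  { intros c; rewrite (pt_map_sect c).
    transitivity (idm N ∘ pt_base_map c); [|apply comp_id_l].
    rewrite comp_assoc; f_equal; exact (refl_sect1 R). }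
  assert (Hb : pt_base_map a = pt_base_map b).
  { rewrite <- (S a), <- (S b), !comp_assoc; f_equal; exact H. }
  apply pt_hom_eq; trivial; apply (d_jointly_mono (r := R)); trivial.
  transitivity (pt_base_map a ∘ proj X); [exact (pt_map_proj a)|].
  rewrite Hb; symmetry; exact (pt_map_proj b).
Qed.

(** An object over zero is the fibre of [nabla U] over zero, so that a
    subobject normal to [R] is the kernel of the point of [R]. *)
Lemma normal_to_kernel (U : point (zero Q)) (N : E) (u : total U ~> N)
    (R : equiv_relation N) :
  normal_to L u R ->
  exists k : PtObj U ⇒ rel_pt R,
    PE_cartesian k /\ d1 R ∘ pt_total_map k = u.
Proof.
  intros H; destruct (normal_to_cartesian H) as [phi [_ [Cphi Hphi]]].
  set (a := pair L (from_zero Q (total U) ∘ proj U) (idm (total U))).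
  assert (Ha : prod1 L (total U) (total U) ∘ a = from_zero Q (total U) ∘ proj U)
    by apply prod1_pair.
  assert (Ha2 : prod2 L (total U) (total U) ∘ a = idm (total U))
    by apply prod2_pair.
  set (k0 := zero_pt_hom (T := rel_pt (nabla_equiv L (total U))) Ha).
  assert (Ck : PE_cartesian k0).
  { apply cartesian_iff_kernel, is_pullback_intro.
    - exact Ha.
    - cbn; intros W x y Hxy; exists (prod2 L _ _ ∘ x).
      split; [|apply to_zero_unique].
      apply prod_eq; rewrite comp_assoc.
      + transitivity (from_zero Q (total U) ∘ proj U ∘ (prod2 L _ _ ∘ x));
          [f_equal; exact Ha|].
        transitivity (from_zero Q (total U) ∘ y); [|symmetry; exact Hxy].
        rewrite <- comp_assoc; f_equal; apply to_zero_unique.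
      + transitivity (idm (total U) ∘ (prod2 L _ _ ∘ x));
          [f_equal; exact Ha2 | apply comp_id_l].
    - cbn; intros W x y Hxy _.
      rewrite <- (comp_id_l x), <- (comp_id_l y), <- Ha2, <- !comp_assoc.
      f_equal; exact Hxy. }
  exists (phi ∘ k0); split; [exact (cartesian_comp Cphi Ck)|]; cbn.
  rewrite comp_assoc.
  transitivity (u ∘ prod2 L (total U) (total U) ∘ a);
    [f_equal; exact Hphi | rewrite <- comp_assoc, Ha2; apply comp_id_r].
Qed.

Lemma kernel_normal_to (U : point (zero Q)) (X : pt E) (u : PtObj U ⇒ X) :
  PE_cartesian u -> normal_to L (pt_total_map u) (kernel_equiv L (proj X)).
Proof.
  intros Cu.
  pose proof (mono_cartesian L Cu (@from_zero_mono _ _ _ _ _)) as Mu.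
  apply (mono_levels L) in Mu; destruct Mu as [_ Mu].
  apply cartesian_iff_kernel in Cu.
  assert (Hz : forall W (a : W ~> total U),
             proj X ∘ (pt_total_map u ∘ a) = from_zero Q (base X) ∘ (proj U ∘ a)).
  { intros W a; rewrite !comp_assoc; f_equal; exact (proj1 Cu). }
  assert (H : proj X ∘ (pt_total_map u ∘ prod1 L (total U) (total U)) =
              proj X ∘ (pt_total_map u ∘ prod2 L (total U) (total U))).
  { rewrite !Hz; f_equal; apply to_zero_unique. }
  apply normal_to_intro with (phi := pb_lift L H); trivial.
  - apply pb_lift1.
  - apply pb_lift2.
  - apply is_pullback_intro; cbn.
    + apply pb_lift1.
    + intros W a b Hab.
      assert (Ha : proj X ∘ (pb2 L _ _ ∘ a) =
                   from_zero Q (base X) ∘ (proj U ∘ b)).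
      { rewrite comp_assoc, <- pb_comm, <- comp_assoc, Hab; apply Hz. }
      destruct (proj2 Cu _ _ _ Ha) as [c [[H1 _] _]].
      exists (pair L b c); split; [|apply prod1_pair].
      apply (d_jointly_mono (r := kernel_rel L (proj X))); cbn.
      * rw (pb_lift1 L H); rewrite Hab; f_equal; apply prod1_pair.
      * rw (pb_lift2 L H); rewrite <- H1; f_equal; apply prod2_pair.
    + intros W a b H1 H2; apply prod_eq; trivial; apply Mu.
      rewrite !comp_assoc.
      transitivity (pb2 L (proj X) (proj X) ∘ pb_lift L H ∘ a);
        [f_equal; symmetry; apply pb_lift2|].
      transitivity (pb2 L (proj X) (proj X) ∘ pb_lift L H ∘ b);
        [rewrite <- !comp_assoc; f_equal; exact H1 | f_equal; apply pb_lift2].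
Qed.

Lemma to_kernel_pair_ok (X : pt E) :
  proj X ∘ (sect X ∘ proj X) = proj X ∘ idm (total X).
Proof. now rewrite comp_assoc, proj_sect, comp_id_l, comp_id_r. Qed.

Lemma to_kernel_pair_sect (X : pt E) :
  pb_lift L (to_kernel_pair_ok X) ∘ sect X =
  refl_sect (kernel_equiv L (proj X)) ∘ sect X.
Proof.
  apply (d_jointly_mono (r := kernel_equiv L (proj X))).
  - rw (refl_sect0 (kernel_equiv L (proj X))); cbn.
    rw (pb_lift1 L (to_kernel_pair_ok X)).
    now rewrite proj_sect, comp_id_l, comp_id_r.
  - rw (refl_sect1 (kernel_equiv L (proj X))); cbn.
    now rw (pb_lift2 L (to_kernel_pair_ok X)).
Qed.

(** The map [x |-> (s (f x), x)] of a point [(f, s)] to the kernel pair of [f]. *)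
Definition to_kernel_pair (X : pt E) : X ⇒ rel_pt (kernel_equiv L (proj X)) :=
  @PtHom E X (rel_pt (kernel_equiv L (proj X))) (sect X) _
    (pb_lift1 L (to_kernel_pair_ok X)) (to_kernel_pair_sect X).

(** In group-theoretic terms [T] is the semidirect product of its kernel by its
    base [Y], and [U] is a subgroup of the kernel. The decomposition consists
    of the part [Z] of [Y] that normalizes [U], acting on [U]: here [N] is the
    normalizer of [U] in [T], [Z] its inverse image along the section of [T],
    and the action is the restriction to [Z] of the point of the relation [R]
    on [N]. *)
Section Construction.
Hypothesis PM : protomodular L.
Variables (U : point (zero Q)) (T : pt E) (v : PtObj U ⇒ T).
Variables (N : E) (u : total U ~> N) (R : equiv_relation N) (w : N ~> total T).
Hypotheses (Nu : normal_to L u R) (Hv : pt_total_map v = w ∘ u).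
Hypothesis Univ : forall (X' : E) (u' : total U ~> X') (R' : equiv_relation X')
  (w' : X' ~> total T), normal_to L u' R' -> pt_total_map v = w' ∘ u' ->
  exists! t : X' ~> N, w ∘ t = w' /\ t ∘ u' = u /\
    rel_incl R' (inverse_image L t R).

(** The two sides agree on the diagonal and on the kernel [U] of the point of
    [R], which the projection of [T] sends to zero. *)
Lemma proj_coequalizes : proj T ∘ (w ∘ d0 R) = proj T ∘ (w ∘ d1 R).
Proof.
  destruct (normal_to_kernel Nu) as [k [Ck Hk]].
  apply (@jointly_epi E L PM (PtObj U) (rel_pt R) k _ _ _ Ck).
  - rewrite <- !comp_assoc; transitivity (from_zero Q (base T) ∘ proj U).
    + transitivity (proj T ∘ (w ∘ (pt_base_map k ∘ proj U))).
      * do 2 f_equal; exact (pt_map_proj k).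
      * rewrite !comp_assoc; f_equal; apply from_zero_unique.
    + symmetry; transitivity (proj T ∘ (w ∘ u)); [do 2 f_equal; exact Hk|].
      rewrite <- Hv; transitivity (pt_base_map v ∘ proj U).
      * exact (pt_map_proj v).
      * f_equal; apply from_zero_unique.
  - cbn; rewrite <- !comp_assoc; now rewrite refl_sect0, refl_sect1.
Qed.

Let Z : E := pb L w (sect T).
Let n : Z ~> N := pb1 L w (sect T).
Let y : Z ~> base T := pb2 L w (sect T).

Let X : pt E := base_change_pt L (id_pt_hom (X := rel_pt R) n).
Let q : X ⇒ rel_pt R := base_change_pt_proj L (id_pt_hom (X := rel_pt R) n).

Lemma action_proj_ok :
  proj T ∘ (w ∘ (d1 R ∘ pt_total_map q)) = y ∘ proj X.
Proof.
  rewrite !comp_assoc, <- (comp_assoc (proj T) w), <- proj_coequalizes.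
  rewrite <- !comp_assoc.
  transitivity (proj T ∘ (w ∘ (n ∘ proj X))).
  - do 2 f_equal; exact (pt_map_proj q).
  - transitivity (proj T ∘ (sect T ∘ y ∘ proj X)).
    + f_equal; rewrite comp_assoc; f_equal; apply pb_comm.
    + now rewrite !comp_assoc, proj_sect, comp_id_l.
Qed.

Lemma action_sect_ok : w ∘ (d1 R ∘ pt_total_map q) ∘ sect X = sect T ∘ y.
Proof.
  rewrite <- !comp_assoc.
  transitivity (w ∘ (d1 R ∘ (refl_sect R ∘ n))).
  - do 2 f_equal; exact (pt_map_sect q).
  - rewrite (comp_assoc (d1 R)), refl_sect1, comp_id_l; apply pb_comm.
Qed.

Definition action_map : X ⇒ T :=
  @PtHom E X T y (w ∘ (d1 R ∘ pt_total_map q)) action_proj_ok action_sect_ok.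

Lemma extremal_of_normalizer :
  exists u0 : PtObj U ⇒ X,
    is_extremal_decomposition (@PE_cartesian E) v u0 action_map.
Proof.
  destruct (normal_to_kernel Nu) as [k [Ck Hk]].
  assert (Cq : PE_cartesian q) by apply base_change_pt_cartesian.
  destruct (Cq (PtObj U) k (from_zero Q Z) (from_zero_unique _ _))
    as [u0 [[Hu0 _] _]].
  components Hu0 Hu0b Hu0t.
  exists u0; split; [|split].
  - apply zero_pt_hom_eq; cbn; rewrite Hv, <- Hk, <- !comp_assoc.
    do 2 f_equal; now symmetry.
  - apply (cartesian_cancel Cq); now rewrite Hu0.
  - intros X' u' w' Hv' Cu'; components Hv' Hvb' Hvt'.
    destruct (Univ (kernel_normal_to Cu') Hvt') as [t [[Ht1 [Ht2 Ht3]] Ut]].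
    apply rel_incl_inverse_image in Ht3; destruct Ht3 as [s [Hs0 Hs1]].
    set (g := rel_pt_hom (R := kernel_equiv L (proj X')) (R' := R) Hs0 Hs1
              ∘ to_kernel_pair X' : X' ⇒ rel_pt R).
    assert (Hg : d1 R ∘ pt_total_map g = t).
    { cbn; rewrite comp_assoc.
      transitivity (t ∘ (pb2 L (proj X') (proj X') ∘ pb_lift L (to_kernel_pair_ok X')));
        [rewrite comp_assoc; f_equal; exact Hs1|].
      now rewrite pb_lift2, comp_id_r. }
    assert (Hb : w ∘ (t ∘ sect X') = sect T ∘ pt_base_map w').
    { rewrite comp_assoc, Ht1; apply pt_map_sect. }
    destruct (Cq X' g (pb_lift L Hb) (pb_lift1 L Hb)) as [h [[H1 H2] _]].
    components H1 H1b H1t; cbn in H2.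
    exists h; split; [split|].
    + apply pt_hom_eq; cbn.
      * rewrite H2; apply pb_lift2.
      * rewrite <- !comp_assoc, <- Ht1; f_equal; rewrite <- Hg; f_equal.
        exact H1t.
    + apply (cartesian_eq Cq); [|apply from_zero_unique].
      rewrite comp_assoc, H1, Hu0; apply rel_pt_eq.
      rewrite Hk, <- Ht2, <- Hg, <- comp_assoc; reflexivity.
    + (* A competitor [h'] of [h] composes to a competitor of [t]: two elements
         of a fibre of [X'] have images in the same fibre of [X], hence in the
         same class of [R]. *)
      intros h' [H3 H4]; components H3 H3b H3t; components H4 H4b H4t.
      assert (E' : t = d1 R ∘ pt_total_map (q ∘ h')).
      { apply Ut; split; [|split]; cbn.
        - rewrite <- H3t, <- !comp_assoc; reflexivity.
        - rewrite <- Hk, <- Hu0t, <- H4t, <- !comp_assoc; reflexivity.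
        - apply rel_incl_inverse_image.
          set (K := kernel_equiv L (proj X')).
          set (z := pt_total_map (q ∘ h') : total X' ~> R).
          assert (Hz : d0 R ∘ z = pt_base_map (q ∘ h') ∘ proj X')
            by exact (pt_map_proj (q ∘ h')).
          assert (Hd : d0 R ∘ (z ∘ d0 K) = d0 R ∘ (z ∘ d1 K)).
          { rewrite !comp_assoc, Hz, <- !comp_assoc; f_equal.
            exact (pb_comm L (proj X') (proj X')). }
          pose proof (equiv_rel_equivalence R K) as Eq.
          refine (@Equivalence_Transitive _ _ Eq _ (d0 R ∘ (z ∘ d0 K)) _ _ _).
          + apply (@Equivalence_Symmetric _ _ Eq).
            exists (z ∘ d0 K); split; [reflexivity | apply comp_assoc].
          + exists (z ∘ d1 K); split; [now symmetry | apply comp_assoc]. }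
      assert (Hq : q ∘ h' = g) by (apply rel_pt_eq; now rewrite Hg).
      apply (cartesian_eq Cq); [congruence|].
      rewrite H2; apply (is_pullback_eq (pb_pullback L w (sect T))).
      * rewrite pb_lift1; symmetry; exact (f_equal (@pt_base_map _ _ _) Hq).
      * rewrite pb_lift2; now symmetry.
Qed.

End Construction.

Lemma decomposable_over_zero_of_normalizers :
  protomodular L ->
  (forall (U T : E) (u : U ~> T), mono u -> has_normalizer L u) ->
  decomposable_over_zero Q.
Proof.
  intros PM H U T v Mv.
  destruct (H _ _ _ (proj2 (mono_levels L Mv))) as (N & u & R & w & Nu & Hv & Un).
  destruct (extremal_of_normalizer PM Nu Hv Un) as [u0 Ew].
  eexists; exists u0; eexists; exact Ew.
Qed.

End FromNormalizers.

Theorem theorem6p1 (E : category) (L : finitely_complete E)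
    (Q : quasi_pointed L) :
  (P_decomposable E -> pre_fibrant_on_monos (kernel_functor Q)) /\
  (protomodular L ->
    ((P_decomposable E <-> pre_fibrant_on_monos (kernel_functor Q)) /\
     (pre_fibrant_on_monos (kernel_functor Q) <->
        forall (U T : E) (u : U ~> T), mono u -> has_normalizer L u)) /\
    (P_decomposable E -> stably_P_decomposable E)).
Proof.
  assert (H12 : P_decomposable E -> pre_fibrant_on_monos (kernel_functor Q)).
  { intros D; apply pre_fibrant_of_decomposable; intros U T v; apply D. }
  split; [exact H12 | intros PM].
  assert (H21 : pre_fibrant_on_monos (kernel_functor Q) -> P_decomposable E).
  { intros P; apply (decomposable_of_over_zero PM (Q := Q)).
    now apply decomposable_of_pre_fibrant. }
  split; [split; split; trivial|].
  - intros P U T v Mv.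
    destruct (H21 P _ _ _ (nabla_map_mono (L := L) Mv)) as [X [u [w Ew]]].
    exact (normalizer_of_decomposition Mv Ew).
  - intros N; apply pre_fibrant_of_decomposable.
    now apply decomposable_over_zero_of_normalizers.
  - intros D; split; [exact D | exact (extremal_stable PM Q D)].
Qed.
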